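(* Let $X$ be a smooth projective complex curve of genus $\ge 2$ with an action of the symmetric group $S_4$ (so $S_4\subset\mathrm{Aut}(X)$), and let $Y=X/S_4$. Let $A_4\subset S_4$ be the alternating group, $S_3\subset S_4$ the stabilizer of the symbol $1$, $D_4\subset S_4$ the subgroup generated by $(13)$ and $(1234)$, and $Z=\langle(1234)\rangle$. For a subgroup $M\subset S_4$ write $X_M=X/M$. Then $$JX\sim JY\times P(X_{A_4}/Y)\times P(X_{D_4}/Y)^2\times P(X_{S_3}/Y)^3\times P(X_Z/X_{D_4})^3.$$
   Context: $JX$ is the Jacobian of $X$; $\sim$ means ''isogenous to''. For a finite morphism $f:X'\to Y'$ of smooth projective curves, the Prym variety is $P(X'/Y'):=\ker(\mathrm{Nm} f:JX'\to JY')^{\circ}$, the connected component of $0$ of the kernel of the norm map. *)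

(* Defs.v *)
(* Classical projective varieties over the complex numbers R[i], in the language
   of spaces with functions: a variety is a type of closed points together with
   its Zariski topology and its sheaf of regular complex-valued functions. *)
From HB Require Import structures.
From mathcomp Require Export all_boot all_order all_algebra all_fingroup.
From mathcomp Require Export alt.
From mathcomp Require Export boolp classical_sets functions cardinality reals.
From mathcomp Require Export complex freeg mpoly.

Set Implicit Arguments.
Unset Strict Implicit.
Unset Printing Implicit Defensive.

Import Order.TTheory GRing.Theory Num.Theory.

Local Open Scope classical_set_scope.
Local Open Scope ring_scope.

Section SpacesWithFunctions.
Variable R : realType.
Local Notation C := R[i].

(* [fn_regular U f] is only meaningful for [U] open, and must depend only on the
   restriction of the total function [f] to [U]. *)
Record fstruct (T : Type) := FStruct {
  fn_open : set (set T);
  fn_regular : set T -> set (T -> C)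
}.

Definition fn_closed T (S : fstruct T) (Z : set T) := fn_open S (~` Z).

Definition morphism T T' (S : fstruct T) (S' : fstruct T') (f : T -> T') :=
  forall U, fn_open S' U ->
    fn_open S (f @^-1` U) /\
    forall h, fn_regular S' U h -> fn_regular S (f @^-1` U) (h \o f).

Definition sub_struct (T : choiceType) (S : fstruct T) (Z : set T) : fstruct Z :=
  FStruct
    [set U | exists2 V, fn_open S V & U = [set z : Z | V (val z)]]
    (fun U h => forall z : Z, U z ->
       exists V k, [/\ fn_open S V, V (val z), fn_regular S V k &
         forall y : Z, U y -> V (val y) -> h y = k (val y)]).

(* Restrictions to V x W of the elements of O(V) (x) O(W). *)
Definition tensor T T' (S : fstruct T) (S' : fstruct T')
    (V : set T) (W : set T') : set (T * T' -> C) :=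
  [set h | exists (m : nat) (u : 'I_m -> T -> C) (v : 'I_m -> T' -> C),
    [/\ forall i, fn_regular S V (u i), forall i, fn_regular S' W (v i) &
        h = fun x => \sum_(i < m) u i x.1 * v i x.2]].

(* The product in the category of varieties: its topology is generated by the
   non-vanishing loci in V x W of elements of O(V) (x) O(W), and its regular
   functions are locally quotients of such elements. *)
Definition prod_struct T T' (S : fstruct T) (S' : fstruct T') :
    fstruct (T * T') :=
  FStruct
    [set U | forall x, U x -> exists V W h,
       [/\ fn_open S V, fn_open S' W, V x.1 /\ W x.2, tensor S S' V W h &
           h x != 0 /\
           forall y, V y.1 -> W y.2 -> h y != 0 -> U y]]
    (fun U f => forall x, U x -> exists V W h k,
       [/\ fn_open S V /\ fn_open S' W, V x.1 /\ W x.2,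
           tensor S S' V W h /\ tensor S S' V W k, k x != 0 &
           forall y, U y -> V y.1 -> W y.2 -> k y != 0 -> f y = h y / k y]).

Definition isomorphism T T' (S : fstruct T) (S' : fstruct T') (f : T -> T') :=
  morphism S S' f /\
  exists g, [/\ morphism S' S g, cancel f g & cancel g f].

(* [i] is an isomorphism from [T] onto the subspace [Z] of [T']. *)
Definition isom_onto T (T' : choiceType) (S : fstruct T) (S' : fstruct T')
    (Z : set T') (i : T -> T') :=
  exists2 k : T -> Z, isomorphism S (sub_struct S' Z) k &
    forall x, i x = val (k x).

(* A point of P^n is represented by its unique homogeneous coordinate vector
   whose first nonzero coordinate is 1. *)
Definition normalized n (v : 'rV[C]_n.+1) : bool :=
  [exists i, (v 0 i == 1) && [forall j : 'I_n.+1, (j < i)%N ==> (v 0 j == 0)]].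

Definition pspace n : choiceType := {v : 'rV[C]_n.+1 | normalized v}.

Definition peval n (p : {mpoly C[n.+1]}) (x : pspace n) : C :=
  p.@[fun i => val x 0 i].

Definition pspace_open n : set (set (pspace n)) :=
  [set U | exists2 P : set {mpoly C[n.+1]},
     forall p, P p -> exists d, p \is d.-homog &
     U = [set x | exists2 p, P p & peval p x != 0]].

Definition pspace_struct n : fstruct (pspace n) :=
  FStruct (@pspace_open n)
    (fun U f => forall x, U x ->
       exists (V : set (pspace n)) (d : nat) (p q : {mpoly C[n.+1]}),
       [/\ pspace_open V, V x, p \is d.-homog, q \is d.-homog &
           forall y, U y -> V y ->
             peval q y != 0 /\ f y = peval p y / peval q y]).

Definition projective T (S : fstruct T) :=
  exists n (Z : set (pspace n)) (i : T -> pspace n),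
    fn_closed (pspace_struct n) Z /\ isom_onto S (pspace_struct n) Z i.

Definition irreducible_set T (S : fstruct T) (Z : set T) :=
  Z !=set0 /\
  forall U V, fn_open S U -> fn_open S V ->
    Z `&` U !=set0 -> Z `&` V !=set0 -> Z `&` (U `&` V) !=set0.

Definition connected_set T (S : fstruct T) (Z : set T) :=
  forall U V, fn_open S U -> fn_open S V ->
    Z `<=` U `|` V -> Z `&` (U `&` V) = set0 -> Z `<=` U \/ Z `<=` V.

Definition component T (S : fstruct T) (Z : set T) (x : T) : set T :=
  [set y | exists A, [/\ connected_set S A, A `<=` Z, A x & A y]].

Definition irreducible_chain T (S : fstruct T) (n : nat) (Z : nat -> set T) :=
  (forall i, (i <= n)%N -> fn_closed S (Z i) /\ irreducible_set S (Z i)) /\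
  (forall i, (i < n)%N -> Z i `<` Z i.+1).

Definition krull_dim T (S : fstruct T) (d : nat) :=
  (exists Z, irreducible_chain S d Z) /\
  ~ (exists Z, irreducible_chain S d.+1 Z).

Definition regular_at T (S : fstruct T) (x : T) (f : T -> C) :=
  exists U, [/\ fn_open S U, U x & fn_regular S U f].

(* Point derivations of the local ring at [x], i.e. the dual of m_x / m_x^2.
   Their values on functions that are not regular at [x] are irrelevant. *)
Definition tangent T (S : fstruct T) (x : T) (D : (T -> C) -> C) :=
  [/\ forall f g U, regular_at S x f -> regular_at S x g ->
        fn_open S U -> U x -> (forall y, U y -> f y = g y) -> D f = D g,
      forall (a : C) f g, regular_at S x f -> regular_at S x g ->
        D (fun y => a * f y + g y) = a * D f + D g &
      forall f g, regular_at S x f -> regular_at S x g ->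
        D (fun y => f y * g y) = f x * D g + g x * D f].

Definition tangent_dim T (S : fstruct T) (x : T) (d : nat) :=
  exists e : 'I_d -> (T -> C) -> C,
    (forall i, tangent S x (e i)) /\
    forall D, tangent S x D -> exists! c : 'rV[C]_d,
      forall f, regular_at S x f -> D f = \sum_(i < d) c 0 i * e i f.

Definition smooth T (S : fstruct T) (d : nat) :=
  forall x, tangent_dim S x d.

(* Regular differential 1-forms: a field of linear forms on the tangent spaces
   that is locally of the form sum_i a_i dg_i. *)
Definition oneform T := T -> ((T -> C) -> C) -> C.

Definition regular_form T (S : fstruct T) (w : oneform T) :=
  forall x, exists U (m : nat) (a g : 'I_m -> T -> C),
    [/\ fn_open S U, U x,
        forall i, fn_regular S U (a i), forall i, fn_regular S U (g i) &
        forall y D, U y -> tangent S y D ->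
          w y D = \sum_(i < m) a i y * D (g i)].

(* dim H^0(X, Omega^1) = g *)
Definition genus T (S : fstruct T) (g : nat) :=
  exists e : 'I_g -> oneform T,
    (forall i, regular_form S (e i)) /\
    forall w, regular_form S w -> exists! c : 'rV[C]_g,
      forall y D, tangent S y D -> w y D = \sum_(i < g) c 0 i * e i y D.

Record curve := Curve {
  curve_pt :> choiceType;
  curve_fn : fstruct curve_pt;
  curve_projective : projective curve_fn;
  curve_irreducible : irreducible_set curve_fn setT;
  curve_dim1 : krull_dim curve_fn 1;
  curve_smooth : smooth curve_fn 1
}.

Section Divisors.
Variable X : curve.

Definition uniformizer (x : X) (t : X -> C) :=
  [/\ regular_at (curve_fn X) x t, t x = 0 &
      exists2 D, tangent (curve_fn X) x D & D t != 0].

(* [f] is t ^ k times a unit near [x]; [f] may be a pole at, and take an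
   arbitrary value in, the point [x] itself. *)
Definition has_order (x : X) (f : X -> C) (k : int) :=
  exists t u V,
    [/\ uniformizer x t, regular_at (curve_fn X) x u, u x != 0,
        fn_open (curve_fn X) V /\ V x &
        forall y, V y -> y != x -> t y != 0 /\ f y = t y ^ k * u y].

Definition principal (D : {freeg X / int}) :=
  exists (f : X -> C) U,
    [/\ fn_open (curve_fn X) U, U !=set0, fn_regular (curve_fn X) U f &
        forall x, has_order x f (coeff x D)].

End Divisors.

Definition pushforward (X Y : curve) (f : X -> Y) (D : {freeg X / int}) :
    {freeg Y / int} :=
  \sum_(x <- dom D) << coeff x D *g f x >>.

(* A commutative group with a structure of space with functions; the two are
   required to be compatible only in [abelian_variety]. *)
Record gspace := GSpace {
  gs_pt :> zmodType;
  gs_fn : fstruct gs_pt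
}.

Definition gprod (A B : gspace) : gspace :=
  GSpace (prod_struct (gs_fn A) (gs_fn B)).

(* The n-th power for n > 0; by convention A itself for n = 0. *)
Definition gpow (A : gspace) (n : nat) : gspace := iter n.-1 (gprod A) A.

Definition abelian_variety (A : gspace) :=
  [/\ projective (gs_fn A), irreducible_set (gs_fn A) setT,
      morphism (prod_struct (gs_fn A) (gs_fn A)) (gs_fn A)
        (fun x => x.1 + x.2) &
      morphism (gs_fn A) (gs_fn A) -%R].

Definition isogenous (A B : gspace) :=
  exists f : {additive A -> B},
    [/\ morphism (gs_fn A) (gs_fn B) f, forall b, exists a, f a = b &
        finite_set [set a | f a = 0]].

(* The group Pic^0(X) of degree 0 divisors modulo principal ones, with its
   structure of abelian variety: the maps x |-> [x - x0] are morphisms, and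
   universal among the morphisms from X to an abelian variety sending x0 to 0.
   [cl] is only meaningful on divisors of degree 0. *)
Definition is_jacobian (X : curve) (J : gspace) (cl : {freeg X / int} -> J) :=
  [/\ abelian_variety J,
      forall D E, deg D = 0 -> deg E = 0 -> cl (D + E) = cl D + cl E,
      forall D, deg D = 0 -> cl D = 0 <-> principal D,
      forall a, exists2 D, deg D = 0 & cl D = a &
      forall x0 : X,
        let aj := fun x => cl (<< 1 *g x >> - << 1 *g x0 >>) in
        morphism (curve_fn X) (gs_fn J) aj /\
        forall (A : gspace) (f : X -> A), abelian_variety A ->
          morphism (curve_fn X) (gs_fn A) f -> f x0 = 0 ->
          exists2 h : {additive J -> A},
            morphism (gs_fn J) (gs_fn A) h & forall x, h (aj x) = f x].

Record jacobian (X : curve) := Jacobian {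
  jac_gs :> gspace;
  jac_class : {freeg X / int} -> jac_gs;
  jac_is_jacobian : is_jacobian jac_class
}.

Definition is_norm (X Y : curve) (f : X -> Y) (JX : jacobian X)
    (JY : jacobian Y) (N : JX -> JY) :=
  forall D, deg D = 0 -> N (jac_class JX D) = jac_class JY (pushforward f D).

Record prym (X Y : curve) (f : X -> Y) (JX : jacobian X) (JY : jacobian Y) :=
Prym {
  prym_gs :> gspace;
  prym_norm : JX -> JY;
  prym_is_norm : is_norm f prym_norm;
  prym_incl : {additive prym_gs -> JX};
  prym_incl_isom : isom_onto (gs_fn prym_gs) (gs_fn JX)
    (component (gs_fn JX) [set a | prym_norm a = 0] 0) prym_incl
}.

(* Mathcomp permutations compose left to right, so actions are right actions;
   this is immaterial for orbits and subgroups. *)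
Definition faithful_algebraic_action (X : curve) (to : {action 'S_4 &-> X}) :=
  (forall s, morphism (curve_fn X) (curve_fn X) (fun x => to x s)) /\
  (forall s, (forall x, to x s = x) -> s = 1%g).

Record quotient_curve (X : curve) (to : {action 'S_4 &-> X})
    (M : {group 'S_4}) := QuotientCurve {
  quo_curve :> curve;
  quo_proj : X -> quo_curve;
  quo_surj : forall y, exists x, quo_proj x = y;
  quo_orbit : forall x y,
    quo_proj x = quo_proj y <-> exists2 s, s \in M & y = to x s;
  quo_open : forall U,
    fn_open (curve_fn quo_curve) U <->
    fn_open (curve_fn X) (quo_proj @^-1` U);
  quo_regular : forall U h, fn_open (curve_fn quo_curve) U ->
    (fn_regular (curve_fn quo_curve) U h <->
     fn_regular (curve_fn X) (quo_proj @^-1` U) (h \o quo_proj))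
}.

Definition induced_morphism (X : curve) (to : {action 'S_4 &-> X})
    (M N : {group 'S_4}) (XM : quotient_curve to M) (XN : quotient_curve to N)
    (f : XM -> XN) :=
  morphism (curve_fn XM) (curve_fn XN) f /\
  forall x, f (quo_proj XM x) = quo_proj XN x.

End SpacesWithFunctions.

(* The symbols 1, 2, 3, 4 are the elements 0, 1, 2, 3 of 'I_4. *)
Definition perm13 : 'S_4 := tperm (inord 0) (inord 2).
Definition perm1234 : 'S_4 := perm (@ordS_inj 4).

Definition grpS4 : {group 'S_4} := [group of [set: 'S_4]].
Definition grpA4 : {group 'S_4} := [group of Alt 'I_4].
Definition grpS3 : {group 'S_4} := [group of 'C[inord 0 : 'I_4 | 'P]%g].
Definition grpD4 : {group 'S_4} := [group of <<[set perm13; perm1234]%SET>>%g].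
Definition grpZ : {group 'S_4} := [group of <[perm1234]>%g].

(* Main.v *)
(* The group S_4 acts on JX, and the norm maps Nm : JX -> J(X/M) and the
   pullbacks J(X/M) -> JX, whose composition is the sum over M of the action,
   come from the universal property of Jacobians together with the fact that
   invariant morphisms descend to X/M. For f : X/M -> X/N the homomorphism
   psi = Nm_M (|N| - sum_(s in N) s) lands in the kernel of Nm f; its image B
   is a closed irreducible divisible group with ker (Nm f) = B + (|N|-torsion),
   and the torsion is finite, so B is open in that kernel and is its component
   of 0, the Prym variety. The isogeny collects Nm_(S_4) and the maps psi
   precomposed with suitable elements of S_4. That it is surjective with finite
   kernel reduces, by divisibility of JX and finiteness of its torsion, to
   identities in Z[S_4], which are computed.

   On an abelian variety A three facts are needed. Images of homomorphisms are
   closed: by elimination the image contains an open subset of its closure, and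
   a subgroup with this property is closed. Torsion is finite: f (n x) = n f (x)
   modulo the square of the maximal ideal at 0, so on A[n] that ideal equals its
   square, 0 is isolated by the determinant trick, and A[n] is a discrete closed
   subset of a noetherian space. A is divisible: the closed subgroups n^k A are
   eventually constant, whence A = n A + A[n^k] is a finite union of translates
   of n A. *)
From HB Require Import structures.
From Stdlib Require Import ZArith.
From mathcomp Require Import ring ssrZ.
Require Import Defs.

Set Implicit Arguments.
Unset Strict Implicit.
Unset Printing Implicit Defensive.

Import Order.TTheory GRing.Theory Num.Theory.

Local Open Scope ring_scope.
Local Delimit Scope Z_scope with coqZ.

(** * Prime ideals, extension of points and noetherian rings *)

(** The exponents are dimensions. Over Q the irreducible representations of S_4 are the trivial one,
    the sign, V of dimension 2, the standard W of dimension 3, and W tensor sign. The permutation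
    representations on the cosets of A_4, D_4 and S_3 are the trivial one plus the sign, V and W
    respectively, and that of Z is that of D_4 plus W tensor sign. Writing N_M for the sum over M,
    the operator N_M (|N| - N_N) of each pair M, N is therefore zero in all irreducible
    representations but one, where it is a multiple of a projector of rank one. Precomposing it with
    as many group elements as the dimension gives 1 + 1 + 2 + 3 + 3 = 10 operators that together
    separate Q[S_4]. The proof states none of this: it exhibits a dual system inside Z[S_4], and two
    finite identities replace representation theory. The map to a Prym variety and its operator on
    JX have the same kernel only up to multiplication by 24, so every comparison is made modulo
    torsion. Divisibility then absorbs the multipliers in the proof of surjectivity, and finiteness
    of torsion absorbs them in the kernel. *)

Record prime_ideal (D : comNzRingType) (I : D -> Prop) : Prop := PrimeIdeal {
  prime0 : I 0;
  primeD : forall a b, I a -> I b -> I (a + b);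
  primeMl : forall a b, I b -> I (a * b);
  prime1 : ~ I 1;
  primeM : forall a b, I (a * b) -> I a \/ I b }.

Section PrimeTheory.
Variables (D : comNzRingType) (I : D -> Prop) (PI : prime_ideal I).
Lemma primeMr a b : I a -> I (a * b).
Proof. by rewrite mulrC; apply: primeMl. Qed.
Lemma primeN a : I a -> I (- a).
Proof. by rewrite -mulN1r; apply: primeMl. Qed.
Lemma primeB a b : I a -> I b -> I (a - b).
Proof. by move=> Ia Ib; apply: (primeD PI) => //; apply: primeN. Qed.
Lemma prime_sum (T : Type) (r : seq T) (P : pred T) (F : T -> D) :
  (forall i, P i -> I (F i)) -> I (\sum_(i <- r | P i) F i).
Proof. by move=> H; apply: big_ind H; [exact: prime0|exact: primeD]. Qed.
Lemma prime_exp a k : I (a ^+ k) -> I a.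
Proof.
elim: k => [/(prime1 PI)//|k IH]; rewrite exprS => /(primeM PI) [//|]; exact: IH.
Qed.
Lemma primeBr a b : I (a - b) -> I a -> I b.
Proof. by move=> Iab Ia; rewrite -[b](subKr a); apply: primeB. Qed.
End PrimeTheory.

Lemma prime_preim (D S : comNzRingType) (f : {rmorphism D -> S}) (I : S -> Prop) :
  prime_ideal I -> prime_ideal (fun d => I (f d)).
Proof.
move=> PI; split.
- by rewrite rmorph0; apply: prime0.
- by move=> a b; rewrite rmorphD; apply: primeD.
- by move=> a b; rewrite rmorphM; apply: primeMl.
- by rewrite rmorph1; apply: prime1.
- by move=> a b; rewrite rmorphM; apply: primeM.
Qed.

Section JDegree.
Variables (D : comNzRingType) (J : D -> Prop) (PJ : prime_ideal J).
Implicit Types p q r s : {poly D}.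

(* The degree of the image of p over D / J is n. *)
Definition degree_mod p n := ~ J p`_n /\ forall k, (n < k)%N -> J p`_k.

Lemma degree_mod_or p : (forall k, J p`_k) \/ exists n, degree_mod p n.
Proof.
have [|H] := pselect (forall k, J p`_k); first by left.
right; have H0 m : (forall k, (m <= k)%N -> J p`_k) -> exists n, degree_mod p n.
  elim: m => [Hm|m IH Hm]; first by case: H => k; apply: Hm.
  have [Jm|nJm] := pselect (J p`_m); last by exists m.
  by apply: IH => k; rewrite leq_eqVlt => /orP[/eqP <-//|]; apply: Hm.
by apply: (H0 (size p)) => k hk; rewrite nth_default //; apply: prime0.
Qed.

Lemma prime_coefM p q : (forall k, J p`_k) -> forall k, J (q * p)`_k.
Proof.
move=> H k; rewrite coefM; apply: (prime_sum PJ) => i _.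
by apply: primeMl.
Qed.

Lemma degree_mod_mul p q m n :
  degree_mod p m -> degree_mod q n -> ~ J (p * q)`_(m + n).
Proof.
move=> [Jp Hp] [Jq Hq] Jpq; rewrite coefM in Jpq.
have im : (m < (m + n).+1)%N by rewrite ltnS leq_addr.
rewrite (bigD1 (Ordinal im)) //= addKn in Jpq.
have /(primeM PJ) [] // : J (p`_m * q`_n).
rewrite -[_ * _](addrK (\sum_(i < (m + n).+1 | i != Ordinal im) p`_i * q`_(m + n - i))).
apply: (primeB PJ) => //; apply: (prime_sum PJ) => i.
rewrite -val_eqE /= neq_ltn => /orP[lim|lmi].
  by apply: (primeMl PJ); apply: Hq; rewrite ltn_subRL ltn_add2r.
by apply: (primeMr PJ); apply: Hp.
Qed.

Lemma pseudo_div p n : degree_mod p n -> forall q, exists k r s,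
  [/\ p`_n ^+ k *: q = r * p + s & forall j, (n <= j)%N -> J s`_j].
Proof.
move=> [Jp Hp] q.
have [N] := ubnP (size q).
(* The induction is on a bound for the degree modulo J: coefficients above the bound lie in J but
   may be nonzero, so [size] need not drop when the top term is cancelled. *)
suff H : forall N q, (forall j, (N <= j)%N -> J q`_j) -> exists k r s,
  [/\ p`_n ^+ k *: q = r * p + s & forall j, (n <= j)%N -> J s`_j].
  by move=> _; apply: (H (size q)) => j hj; rewrite nth_default //; apply: prime0.
move=> {q}{}N; elim: N => [|N IH] q HN.
  by exists 0%N, 0, q; split=> [|j _]; rewrite ?expr0 ?scale1r ?mul0r ?add0r //; apply: HN.
have [leNn|ltnN] := ltnP N n.
  exists 0%N, 0, q; split=> [|j hj]; rewrite ?expr0 ?scale1r ?mul0r ?add0r //; apply: HN.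
  exact: leq_trans hj.
set q' := p`_n *: q - (q`_N *: 'X^(N - n)) * p.
have /IH [k [r [s [E Hs]]]] : forall j, (N <= j)%N -> J q'`_j.
  move=> j hj; rewrite /q' coefB coefZ -scalerAl coefZ coefXnM.
  have hj2 : (j < N - n)%N = false by apply/negbTE; rewrite -leqNgt (leq_trans (leq_subr _ _)).
  rewrite hj2; move: hj; rewrite leq_eqVlt => /orP[/eqP <-|hj].
    by rewrite subKn // mulrC subrr; apply: prime0.
  apply: (primeB PJ); apply: (primeMl PJ); first exact: HN.
  by apply: Hp; rewrite ltn_subRL addnC subnKC.
exists k.+1, (r + p`_n ^+ k *: (q`_N *: 'X^(N - n))), s; split=> //.
have -> : p`_n ^+ k.+1 *: q = p`_n ^+ k *: q' + p`_n ^+ k *: (q`_N *: 'X^(N - n) * p).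
  by rewrite -scalerDr /q' subrK scalerA exprSr.
by rewrite E mulrDl -[X in _ = _ + X + _]scalerAl addrAC.
Qed.
End JDegree.

Definition nat_least (P : nat -> Prop) n := P n /\ forall m, P m -> (n <= m)%N.
Lemma nat_leastP (P : nat -> Prop) n : P n -> exists m, nat_least P m.
Proof.
move=> Pn; have ex : exists n, `[<P n>] by exists n; apply/asboolP.
have [m /asboolP Pm H] := ex_minnP ex.
by exists m; split=> // k Pk; apply: H; apply/asboolP.
Qed.

(** Chevalley's theorem for points: in the closure of the image of the zero set of I, every point
    with u != 0 lifts to a point of that zero set with v != 0. Prescribing [v] is what allows the
    property to be iterated. *)
Definition extends_points (F : closedFieldType) (D S : comNzRingType)
    (theta : {rmorphism D -> S}) :=
  forall (I : S -> Prop) (v : S), prime_ideal I -> ~ I v ->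
  exists2 u : D, ~ I (theta u) &
    forall chi : {rmorphism D -> F}, (forall d, I (theta d) -> chi d = 0) ->
      chi u != 0 ->
      exists chi' : {rmorphism S -> F},
        [/\ forall s, I s -> chi' s = 0, chi' v != 0 & forall d, chi' (theta d) = chi d].

Lemma horner_map_extends (F : closedFieldType) (D : comNzRingType)
   (chi : {rmorphism D -> F}) (x : F) :
  exists chi' : {rmorphism {poly D} -> F},
    forall p, chi' p = (map_poly chi p).[x].
Proof.
have cfu : commr_rmorph chi x by move=> a; apply: mulrC.
by exists (horner_morph cfu).
Qed.

Section Polynomials.
Variables (F : closedFieldType) (D : comNzRingType).
Variables (I : {poly D} -> Prop) (PI : prime_ideal I).
Let J d := I d%:P.
Let PJ : prime_ideal J := prime_preim polyC PI.

Lemma prime_of_coefs (p : {poly D}) : (forall k, J p`_k) -> I p.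
Proof.
move=> H; rewrite -[p]coefK poly_def; apply: (prime_sum PI) => i _.
by rewrite -mul_polyC; apply: (primeMr PI); apply: H.
Qed.

Lemma primeZ (a : D) (p : {poly D}) : I (a *: p) -> J a \/ I p.
Proof. by rewrite -mul_polyC => /(primeM PI). Qed.

(* With p in I of least degree n modulo J, every element of I is a multiple of
   p modulo J up to a power of p`_n, so a point of D with p`_n != 0 extends
   through any root of p. Some c outside J lies in I + (v), and c != 0 forces
   v != 0 at the new point. *)
Lemma extends_points_polyC_aux (v : {poly D}) : ~ I v ->
  exists2 u : D, ~ I u%:P &
    forall chi : {rmorphism D -> F}, (forall d, I d%:P -> chi d = 0) ->
      chi u != 0 ->
      exists chi' : {rmorphism {poly D} -> F},
        [/\ forall s, I s -> chi' s = 0, chi' v != 0 & forall d, chi' d%:P = chi d].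
Proof.
move=> Iv.
(* If all coefficients of all elements of I lie in J, the variable can take any value, and it only
   has to avoid the roots of the image of v. *)
have [[n0 Hn0]|no] := pselect (exists n (p : {poly D}), I p /\ degree_mod J p n); last first.
  have allJ p : I p -> forall k, J p`_k.
    by move=> Ip; have [//|[n Hn]] := degree_mod_or PJ p; case: no; exists n, p.
  have [/prime_of_coefs//|[n [Jn _]]] := degree_mod_or PJ v.
  exists v`_n => // chi chiJ chin.
  have nz : map_poly chi v != 0.
    by apply: contraNneq chin => /polyP/(_ n); rewrite coef_map coef0 => /= ->.
  have [x nx] := closed_nonrootP _ nz.
  have [chi' E] := horner_map_extends chi x.
  exists chi'; split=> [s Is||d]; rewrite ?E // ?map_polyC ?hornerC //.
  suff -> : map_poly chi s = 0 by rewrite horner0.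
  by apply/polyP => k; rewrite coef_map coef0 /=; apply/chiJ/allJ.
have [n [[p [Ip pn]] minn]] :=
  @nat_leastP (fun n => exists p : {poly D}, I p /\ degree_mod J p n) n0 Hn0.
have n_gt0 : (0 < n)%N.
  rewrite lt0n; apply/eqP => en; subst n; case: (pn) => Jp Hp; apply: Jp.
  suff : I (p - (p`_0)%:P) by move=> /(primeBr PI); apply.
  apply: prime_of_coefs => -[|k]; rewrite coefB coefC /= ?subrr; first exact: (prime0 PJ).
  by rewrite subr0; apply: Hp.
have smallI s : I s -> (forall j, (n <= j)%N -> J s`_j) -> forall j, J s`_j.
  move=> Is Hs; have [//|[m [Jm Hm]]] := degree_mod_or PJ s.
  have lt_mn : (m < n)%N by rewrite ltnNge; apply/negP => /Hs.
  by move: (minn m (ex_intro _ s (conj Is (conj Jm Hm)))); rewrite leqNgt lt_mn.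
pose L (w : {poly D}) := exists a i : {poly D}, I i /\ w = a * v + i.
have LI w : I w -> L w by move=> Iw; exists 0, w; rewrite mul0r add0r.
have LD w w' : L w -> L w' -> L (w + w').
  move=> [a [i [Ii ->]]] [a' [i' [Ii' ->]]]; exists (a + a'), (i + i'); split.
    exact: (primeD PI).
  by rewrite mulrDl addrACA.
have LM r w : L w -> L (r * w).
  move=> [a [i [Ii ->]]]; exists (r * a), (r * i); split; first exact: (primeMl PI).
  by rewrite mulrDr mulrA.
have LB w w' : L w -> L w' -> L (w - w').
  by move=> Lw Lw'; rewrite -mulN1r; apply: LD => //; apply: LM.
have Lv : L v by exists 1, 0; rewrite mul1r addr0; split=> //; apply: (prime0 PI).
have [m [[w [Lw wm]] minm]] :
    exists m, nat_least (fun m => exists w : {poly D}, L w /\ degree_mod J w m) m.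
  by apply: (@nat_leastP _ n); exists p; split=> //; apply: LI.
have smallL s : L s -> (forall j, (m <= j)%N -> J s`_j) -> forall j, J s`_j.
  move=> Ls Hs; have [//|[m' [Jm Hm]]] := degree_mod_or PJ s.
  have lt_mn : (m' < m)%N by rewrite ltnNge; apply/negP => /Hs.
  by move: (minm m' (ex_intro _ s (conj Ls (conj Jm Hm)))); rewrite leqNgt lt_mn.
have lemn : (m <= n)%N by apply: minm; exists p; split=> //; apply: LI.
(* Dividing p by w leaves a remainder with coefficients in J, so r * w is in I and primality
   applies. If r is in I, its degree is at least n, and comparing degrees leaves only m = 0. If w is
   in I, then m = n, and dividing v by p would put v in I. *)
have m0 : m = 0%N.
  have [k [r [s [E Hs]]]] := pseudo_div PJ wm p.
  have Js : forall j, J s`_j.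
    apply: smallL => //; have -> : s = w`_m ^+ k *: p - r * w by rewrite E addrC addKr.
    by apply: LB; [rewrite -mul_polyC; apply/LI/(primeMl PI)|apply: LM].
  have : I (r * w).
    have -> : r * w = w`_m ^+ k *: p - s by rewrite E addrK.
    apply: (primeB PI); last exact: prime_of_coefs.
    by rewrite -mul_polyC; apply: (primeMl PI).
  have lead_notJ : ~ J (w`_m ^+ k * p`_n).
    move=> /(primeM PJ) [/(prime_exp PJ)|]; [by case: wm|by case: pn].
  case/(primeM PI) => [Ir|Iw].
    have [Jr|[d rd]] := degree_mod_or PJ r.
      case: lead_notJ; rewrite -coefZ E coefD; apply: (primeD PJ) => //.
      by rewrite mulrC; apply: prime_coefM.
    have led : (n <= d)%N by apply: minn; exists r.
    have [|] := leqP (d + m) n.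
      by move=> H; have := leq_trans H led; rewrite -{2}[d]addn0 leq_add2l leqn0 => /eqP.
    move=> ltn; have := degree_mod_mul PJ rd wm; case.
    have -> : r * w = w`_m ^+ k *: p - s by rewrite E addrK.
    rewrite coefB coefZ; apply: (primeB PJ) => //; apply: (primeMl PJ).
    by case: pn => _; apply.
  have lenm : (n <= m)%N by apply: minn; exists w.
  have emn : m = n by apply/eqP; rewrite eqn_leq lemn.
  have [k' [r' [s' [E' Hs']]]] := pseudo_div PJ pn v.
  have Js' : forall j, J s'`_j.
    apply: smallL; last by rewrite emn.
    have -> : s' = p`_n ^+ k' *: v - r' * p by rewrite E' addrC addKr.
    by apply: LB; [rewrite -mul_polyC; apply: LM|apply/LI/(primeMl PI)].
  have : I (p`_n ^+ k' *: v).
    by rewrite E'; apply: (primeD PI); [apply: (primeMl PI)|apply: prime_of_coefs].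
  by move=> /primeZ [/(prime_exp PJ)|//]; case: pn.
subst m; case: wm => Jw0 Hw.
exists (p`_n * w`_0) => [|chi chiJ].
  by move=> /(primeM PJ) []; [case: pn|].
rewrite rmorphM mulf_eq0 negb_or => /andP[chip chiw].
have szp : size (map_poly chi p) = n.+1.
  apply/eqP; rewrite eqn_leq; apply/andP; split.
    apply/leq_sizeP => j hj; rewrite coef_map /=; apply: chiJ.
    by case: pn => _; apply.
  by rewrite ltnNge; apply: contra chip => /leq_sizeP/(_ n (leqnn _)); rewrite coef_map /= => ->.
have [x /eqP rx] : exists x, root (map_poly chi p) x.
  by apply/closed_rootP; rewrite szp; case: (n) n_gt0.
have [chi' E'] := horner_map_extends chi x.
have chiC d : chi' d%:P = chi d by rewrite E' map_polyC hornerC.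
have chi'J (s : {poly D}) : (forall j, J s`_j) -> chi' s = 0.
  move=> H; rewrite E'; suff -> : map_poly chi s = 0 by rewrite horner0.
  by apply/polyP => k; rewrite coef_map coef0 /=; apply/chiJ/H.
have chiI s : I s -> chi' s = 0.
  move=> Is; have [k [r [t [E Ht]]]] := pseudo_div PJ pn s.
  have Jt : forall j, J t`_j.
    apply: smallI => //; have -> : t = p`_n ^+ k *: s - r * p by rewrite E addrC addKr.
    by apply: (primeB PI); [rewrite -mul_polyC|]; apply: (primeMl PI).
  have : chi' (p`_n ^+ k *: s) = 0.
    by rewrite E rmorphD rmorphM [chi' p]E' rx mulr0 add0r chi'J.
  rewrite -mul_polyC rmorphM polyC_exp rmorphXn /= chiC => /eqP.
  by rewrite mulf_eq0 expf_eq0 (negbTE chip) andbF /= => /eqP.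
exists chi'; split=> //.
case: Lw => a [i [Ii ew]].
have e0 : chi' w = chi w`_0.
  rewrite -chiC; apply/eqP; rewrite -subr_eq0 -rmorphB; apply/eqP/(chi'J (w - (w`_0)%:P)).
  move=> [|j]; rewrite coefB coefC /= ?subrr ?subr0; first exact: (prime0 PJ).
  exact: Hw.
apply: contraNneq chiw => chiv.
by rewrite -e0 ew rmorphD rmorphM chiv mulr0 add0r chiI.
Qed.
End Polynomials.

Lemma extends_points_polyC (F : closedFieldType) (D : comNzRingType) :
  extends_points F (polyC : {rmorphism D -> {poly D}}).
Proof. by move=> I v PI; apply: extends_points_polyC_aux. Qed.


Lemma mpoly_morph_ext (D : comNzRingType) (S : nzRingType) n
    (f g : {rmorphism {mpoly D[n]} -> S}) :
  (forall c, f c%:MP = g c%:MP) -> (forall i, f 'X_i = g 'X_i) -> f =1 g.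
Proof.
move=> fC fX p; rewrite [p]mpolyE !rmorph_sum; apply: eq_bigr => m _.
rewrite -mul_mpolyC !rmorphM fC mpolyXE_id !rmorph_prod.
by congr (_ * _); apply: eq_bigr => i _; rewrite !rmorphXn fX.
Qed.

Section Multi.
Variables (D : comNzRingType) (n : nat).
Let widen_comm :
  commr_rmorph (@mwiden n D : {rmorphism {mpoly D[n]} -> {mpoly D[n.+1]}}) 'X_ord_max.
Proof. by move=> a; apply: mulrC. Qed.
Definition multi : {rmorphism {poly {mpoly D[n]}} -> {mpoly D[n.+1]}} :=
  horner_morph widen_comm.
Lemma multiK (p : {mpoly D[n.+1]}) : multi (muni p) = p.
Proof.
have : multi \o (@muni n D) =1 (idfun : {mpoly D[n.+1]} -> {mpoly D[n.+1]}).
  apply: mpoly_morph_ext => [c|i] /=; first by rewrite muniC /multi /= horner_morphC /= mwidenC.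
  rewrite /muni mmapX mmap1U; case: splitP => j hj; last first.
    rewrite /multi /= horner_morphX; congr 'X__; apply/val_inj; move: hj.
    by rewrite ord1 /= addn0.
  rewrite /multi /= horner_morphC /= mwidenX mnmwiden1; congr 'X__; apply/val_inj.
  by rewrite /= -hj.
by move=> /(_ p).
Qed.
End Multi.

(** One variable at a time: the element u' that must stay nonzero for the last variable plays the
    role of v for the remaining ones. *)
Lemma extends_points_mpolyC (F : closedFieldType) n (D : comNzRingType) :
  extends_points F (@mpolyC n D : {rmorphism D -> {mpoly D[n]}}).
Proof.
elim: n => [|n IH] I v PI Iv.
  have E (p : {mpoly D[0]}) : p = (p@_0%MM)%:MP.
    apply/mpolyP => m; rewrite mcoeffC.
    by have -> : m = 0%MM by [apply/mnmP; case]; rewrite eqxx mulr1.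
  exists (v@_0%MM); first by rewrite /= -E.
  move=> chi chiI chiv.
  exists (chi \o (mcoeff 0%MM : {rmorphism {mpoly D[0]} -> D})); split=> [s Is||d] //=.
    by apply: chiI; rewrite /= -E.
  by rewrite mcoeffC eqxx mulr1.
have PI' := prime_preim (@multi D n) PI.
have [|u' Iu' Hu'] := extends_points_polyC F (v := muni v) PI'; first by rewrite multiK.
have [u Iu Hu] := IH _ u' (prime_preim polyC PI') Iu'.
have multiC d : multi D n (d%:MP)%:P = d%:MP by rewrite /multi /= horner_morphC /= mwidenC.
exists u => [|chi chiI chiu]; first by move: Iu; rewrite multiC.
have [|chi1 [chi1I chi1u chi1E]] := Hu chi _ chiu.
  by move=> d; rewrite multiC; apply: chiI.
have [chi2 [chi2I chi2v chi2E]] := Hu' chi1 chi1I chi1u.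
exists (chi2 \o (@muni n D : {rmorphism {mpoly D[n.+1]} -> {poly {mpoly D[n]}}})).
split=> [s Is||d].
- by apply: chi2I; rewrite multiK.
- exact: chi2v.
- by rewrite -chi1E -chi2E /= muniC.
Qed.

(** * Finitely generated ideals and the Hilbert basis theorem *)

Inductive in_span (D : comNzRingType) (P : D -> Prop) : D -> Prop :=
| in_span0 : in_span P 0
| in_spanS a b x : P b -> in_span P x -> in_span P (a * b + x).

Section Span.
Variables (D : comNzRingType) (P : D -> Prop).
Lemma in_spanD x y : in_span P x -> in_span P y -> in_span P (x + y).
Proof.
by elim=> [|a b z Pb _ IH] Py; rewrite ?add0r // -addrA; apply: in_spanS => //; apply: IH.
Qed.
Lemma in_spanM a x : in_span P x -> in_span P (a * x).
Proof.
elim=> [|c b z Pb _ IH]; first by rewrite mulr0; apply: in_span0.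
by rewrite mulrDr mulrA; apply: in_spanS.
Qed.
Lemma in_span_mem b : P b -> in_span P b.
Proof. by move=> Pb; rewrite -[b]mul1r -[1 * b]addr0; apply: in_spanS => //; apply: in_span0. Qed.
End Span.

Lemma in_span_mono (D : comNzRingType) (P Q : D -> Prop) x :
  (forall b, P b -> in_span Q b) -> in_span P x -> in_span Q x.
Proof.
move=> PQ; elim=> [|a b z Pb _ IH]; first exact: in_span0.
by apply: in_spanD => //; apply/in_spanM/PQ.
Qed.

Record is_ideal (D : comNzRingType) (I : D -> Prop) : Prop := IsIdeal {
  ideal0 : I 0;
  idealD : forall a b, I a -> I b -> I (a + b);
  idealM : forall a b, I b -> I (a * b) }.

Lemma ideal_span (D : comNzRingType) (I P : D -> Prop) x : is_ideal I ->
  (forall b, P b -> I b) -> in_span P x -> I x.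
Proof.
move=> II PI; elim=> [|a b z Pb _ IH]; first exact: ideal0.
by apply: idealD => //; apply: idealM => //; apply: PI.
Qed.

Definition noetherian (D : comNzRingType) :=
  forall I : D -> Prop, is_ideal I -> exists s : seq D,
    (forall b, b \in s -> I b) /\ forall x, I x -> in_span (fun b => b \in s) x.

Lemma noetherian_field (F : fieldType) : noetherian F.
Proof.
move=> I II; have [[a [Ia a0]]|no] := pselect (exists a, I a /\ a != 0).
  exists [:: a]; split=> [b|x Ix]; first by rewrite inE => /eqP ->.
  rewrite -[x](divfK a0); apply/in_spanM/in_span_mem; exact: mem_head.
exists [::]; split=> // x Ix; have [->|x0] := eqVneq x 0; first exact: in_span0.
by case: no; exists x.
Qed.

Lemma noetherian_surj (D S : comNzRingType) (f : {rmorphism D -> S}) (g : S -> D) :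
  cancel g f -> noetherian D -> noetherian S.
Proof.
move=> gK ND I II.
have [|s [sI Is]] := ND (fun d => I (f d)).
  split; first by rewrite rmorph0; apply: ideal0.
    by move=> a b; rewrite rmorphD; apply: idealD.
  by move=> a b; rewrite rmorphM; apply: idealM.
exists [seq f b | b <- s]; split=> [_ /mapP[b sb ->]|x Ix]; first exact: sI.
have : in_span (fun b => b \in s) (g x) by apply: Is; rewrite gK.
rewrite -[in X in _ -> X](gK x); elim=> [|a b z sb _ IH]; first by rewrite rmorph0; apply: in_span0.
by rewrite rmorphD rmorphM; apply: in_spanS => //; apply: map_f.
Qed.

Section HilbertBasis.
Variables (D : comNzRingType) (I : {poly D} -> Prop) (II : is_ideal I).

(** The inequality on the size admits a = 0, which makes this an ideal; multiplying by a power of X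
    makes it increase with k. *)
Let lead_in k a := exists p : {poly D}, [/\ I p, (size p <= k.+1)%N & p`_k = a].

Let lead_raise k l a : lead_in k a -> (k <= l)%N -> lead_in l a.
Proof.
move=> [p [Ip sp pk]] kl; exists ('X^(l - k) * p); split; first exact: idealM.
  apply: leq_trans (size_polyMleq _ _) _; rewrite size_polyXn.
  by apply: leq_trans (leq_add (leqnn _) sp) _; rewrite addnS subnK.
by rewrite coefXnM ltnNge leq_subr /= subKn.
Qed.

Let lead_ideal k : is_ideal (lead_in k).
Proof.
split; first by exists 0; rewrite size_poly0 coef0; split=> //; apply: ideal0.
  move=> a b [p [Ip sp pk]] [q [Iq sq qk]]; exists (p + q); split; first exact: idealD.
    by rewrite (leq_trans (size_polyD _ _)) // geq_max sp.
  by rewrite coefD pk qk.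
move=> a b [q [Iq sq qk]]; exists (a%:P * q); split; first exact: idealM.
  by rewrite mul_polyC (leq_trans (size_scale_leq _ _)).
by rewrite coefCM qk.
Qed.

Let lead_lift k (s : seq D) : (forall a, a \in s -> lead_in k a) ->
  exists t : seq {poly D}, (forall p, p \in t -> I p) /\
    forall a, in_span (fun b => b \in s) a ->
    exists r : {poly D}, [/\ in_span (fun b => b \in t) r, (size r <= k.+1)%N & r`_k = a].
Proof.
move=> H.
suff [t [tI Ht]] : exists t : seq {poly D}, (forall p, p \in t -> I p) /\
    forall a, a \in s -> exists p : {poly D}, [/\ p \in t, (size p <= k.+1)%N & p`_k = a].
  exists t; split=> // a; elim=> [|c b z sb _ [r [tr szr rk]]].
    by exists 0; rewrite size_poly0 coef0; split=> //; apply: in_span0.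
  have [p [tp szp pk]] := Ht _ sb; exists (c%:P * p + r); split.
  - exact: in_spanS.
  - rewrite (leq_trans (size_polyD _ _)) // geq_max szr andbT mul_polyC.
    by rewrite (leq_trans (size_scale_leq _ _)).
  - by rewrite coefD coefCM pk rk.
elim: s H => [|a s IH] H; first by exists [::].
have [|t [tI Ht]] := IH; first by move=> b sb; apply: H; rewrite inE sb orbT.
have [p [Ip szp pk]] := H a (mem_head _ _).
exists (p :: t); split=> [q|b]; rewrite inE => /orP[/eqP ->//|]; first exact: tI.
  by exists p; rewrite mem_head.
by move=> /Ht [q [tq szq qk]]; exists q; rewrite inE tq orbT.
Qed.

Lemma hilbert_basis : noetherian D -> exists s : seq {poly D},
    (forall b, b \in s -> I b) /\ forall x, I x -> in_span (fun b => b \in s) x.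
Proof.
move=> ND.
(* Generators for the elements of bounded size, adding one ideal of leading coefficients at a time.
   They serve below the degree K from which these ideals no longer grow. *)
have small k : exists t : seq {poly D}, (forall p, p \in t -> I p) /\
    forall q, I q -> (size q <= k)%N -> in_span (fun b => b \in t) q.
  elim: k => [|k [t [tI Ht]]].
    exists [::]; split=> // q _; rewrite leqn0 size_poly_eq0 => /eqP ->; exact: in_span0.
  have [s [sL Ls]] := ND _ (lead_ideal k).
  have [t' [t'I Ht']] := lead_lift sL.
  exists (t ++ t'); split=> [p|q Iq szq].
    by rewrite mem_cat => /orP[/tI|/t'I].
  have [|r [t'r szr rk]] := Ht' q`_k; first by apply: Ls; exists q.
  have Ir : I r by apply: ideal_span t'r.
  have -> : q = (q - r) + r by rewrite subrK.
  apply: in_spanD; last first.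
    by apply: in_span_mono t'r => b tb; apply: in_span_mem; rewrite mem_cat tb orbT.
  apply: (@in_span_mono _ (fun b => b \in t)).
    by move=> b tb; apply: in_span_mem; rewrite mem_cat tb.
  apply: Ht; first by apply: idealD => //; rewrite -mulN1r; apply: idealM.
  apply/leq_sizeP => j; rewrite leq_eqVlt coefB => /orP[/eqP <-|kj]; first by rewrite rk subrr.
  by rewrite !nth_default ?subrr // (leq_trans _ kj).
have [|s [sL Ls]] := ND (fun a => exists k, lead_in k a).
  split; first by exists 0%N; apply: ideal0.
    move=> a b [k ka] [l lb]; exists (maxn k l); apply: idealD => //.
      by apply: lead_raise ka _; apply: leq_maxl.
    by apply: lead_raise lb _; apply: leq_maxr.
  by move=> a b [k kb]; exists k; apply: idealM.
have [K HK] : exists K, forall a, a \in s -> lead_in K a.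
  elim: s sL {Ls} => [|a s IH] H; first by exists 0%N.
  have [|K HK] := IH; first by move=> b sb; apply: H; rewrite inE sb orbT.
  have [k ka] := H a (mem_head _ _); exists (maxn k K) => b; rewrite inE => /orP[/eqP ->|/HK].
    by move/lead_raise: ka; apply; apply: leq_maxl.
  by move/lead_raise; apply; apply: leq_maxr.
have [t [tI Ht]] := lead_lift HK; have [t' [t'I Ht']] := small K.
exists (t ++ t'); split=> [p|q].
  by rewrite mem_cat => /orP[/tI|/t'I].
have [N] := ubnP (size q); elim: N q => // N IH q; rewrite ltnS => szq Iq.
have [leqK|ltK] := leqP (size q) K.
  apply: (@in_span_mono _ (fun b => b \in t')); last exact: Ht'.
  by move=> b tb; apply: in_span_mem; rewrite mem_cat tb orbT.
have szq1 : size q = (size q).-1.+1 by rewrite prednK // (leq_ltn_trans _ ltK).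
set l := (size q).-1 in szq1; have Kl : (K <= l)%N by rewrite -ltnS -szq1.
have [|r [tr szr rk]] := Ht q`_l; first by apply: Ls; exists l, q; rewrite -szq1.
have Ir : I r by apply: ideal_span tr.
have -> : q = (q - 'X^(l - K) * r) + 'X^(l - K) * r by rewrite subrK.
apply: in_spanD; last first.
  apply: in_spanM; apply: in_span_mono tr => b tb.
  by apply: in_span_mem; rewrite mem_cat tb.
apply: IH; last by apply: idealD => //; rewrite -mulN1r; do 2!apply: idealM => //.
apply: leq_trans szq; rewrite szq1 ltnS; apply/leq_sizeP => j lj; rewrite coefB coefXnM.
rewrite ltnNge (leq_trans (leq_subr _ _) lj) /=.
move: lj; rewrite leq_eqVlt => /orP[/eqP <-|lj]; first by rewrite subKn // rk subrr.
rewrite !nth_default ?subrr //; last by rewrite szq1.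
by apply: leq_trans szr _; rewrite ltn_subRL addnC subnKC.
Qed.
End HilbertBasis.

Lemma noetherian_poly (D : comNzRingType) : noetherian D -> noetherian {poly D}.
Proof. by move=> ND I II; apply: hilbert_basis. Qed.

Lemma noetherian_mpoly (D : comNzRingType) n : noetherian D -> noetherian {mpoly D[n]}.
Proof.
move=> ND; elim: n => [|n IH].
  apply: (@noetherian_surj _ _ (@mpolyC 0 D) (mcoeff 0%MM)) => // p.
  apply/mpolyP => m; rewrite mcoeffC.
  by have -> : m = 0%MM by [apply/mnmP; case]; rewrite eqxx mulr1.
by apply: (@noetherian_surj _ _ (multi D n) (@muni n D)) (noetherian_poly IH); apply: multiK.
Qed.

(** The ascending chain condition in the form used for chains of closed sets, where p m is a
    polynomial separating the m-th set from the next one. *)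
Lemma noetherian_seq (D : comNzRingType) (p : nat -> D) : noetherian D ->
  exists m, in_span (fun b => exists2 i, (i < m)%N & b = p i) (p m).
Proof.
move=> ND; pose I m := in_span (fun b => exists2 i, (i < m)%N & b = p i).
have I_mono m m' x : (m <= m')%N -> I m x -> I m' x.
  move=> mm'; apply: in_span_mono => b [i im ->]; apply: in_span_mem; exists i => //.
  exact: leq_trans mm'.
have [|s [sI Is]] := ND (fun x => exists m, I m x).
  split; first by exists 0%N; apply: in_span0.
    move=> a b [m ma] [m' mb]; exists (maxn m m'); apply: in_spanD.
      by apply: I_mono ma; apply: leq_maxl.
    by apply: I_mono mb; apply: leq_maxr.
  by move=> a b [m mb]; exists m; apply: in_spanM.
have [K HK] : exists K, forall b, b \in s -> I K b.
  elim: s sI {Is} => [|a s IH] H; first by exists 0%N.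
  have [|K HK] := IH; first by move=> b sb; apply: H; rewrite inE sb orbT.
  have [k ka] := H a (mem_head _ _); exists (maxn k K) => b; rewrite inE => /orP[/eqP ->|/HK].
    by apply: I_mono ka; apply: leq_maxl.
  by apply: I_mono; apply: leq_maxr.
exists K; apply: in_span_mono HK _; apply: Is; exists K.+1.
by apply: in_span_mem; exists K.
Qed.

(** * The group ring of S_4 *)

(* Permutations in one-line notation, and elements of Z[S_4] as formal sums. *)
Definition code := seq nat.
Definition codes : seq code := permutations (iota 0 4).
Definition comp_code (l m : code) : code := [seq nth 0%N m x | x <- l].
Definition inv_code (l : code) : code := [seq index x l | x <- iota 0 4].
Definition perm_of (l : code) : 'S_4 :=
  insubd (1%g : 'S_4) [ffun i : 'I_4 => inord (nth 0%N l i)].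
Definition code_of (s : 'S_4) : code := [seq val (s i) | i <- enum 'I_4].

Definition gring := seq (Z * code).
Definition gcoef (x : gring) (l : code) : Z :=
  foldr (fun p c => if p.2 == l then p.1 + c else c) 0 x.
(** Listing all 24 coefficients in the order of [codes] makes equal elements of the group ring
    syntactically equal, so identities are decided by [==] after computation. *)
Definition gnorm (x : gring) : gring := [seq (gcoef x l, l) | l <- codes].
Definition gadd (x y : gring) : gring := gnorm (x ++ y).
(* Factors are composed in reverse because S_4 acts on the right. *)
Definition gmul (x y : gring) : gring :=
  gnorm [seq (p.1 * q.1, comp_code q.2 p.2) | p <- x, q <- y].
Definition gscale (c : Z) (x : gring) : gring := [seq (c * p.1, p.2) | p <- x].
Definition gelt (l : code) : gring := gnorm [:: (1, l)].
Definition gone := gelt (iota 0 4).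
Definition gset (L : seq code) : gring := gnorm [seq (1, l) | l <- L].
Definition gwf (x : gring) := all (fun p => p.2 \in codes) x.

Lemma codesP (l : code) : l \in codes -> [/\ size l = 4, uniq l & forall x, x \in l -> (x < 4)%N].
Proof.
rewrite mem_permutations => pl; split; first by rewrite (perm_size pl) size_iota.
  by rewrite (perm_uniq pl) iota_uniq.
by move=> x; rewrite (perm_mem pl) mem_iota.
Qed.

Lemma perm_ofE l i : l \in codes -> perm_of l i = inord (nth 0%N l i).
Proof.
move=> /codesP[sl ul ltl]; rewrite /perm_of.
have inj : injectiveb [ffun i : 'I_4 => inord (nth 0%N l i) : 'I_4].
  apply/injectiveP => j k; rewrite !ffunE => /(congr1 (@nat_of_ord 4)).
  have lt m : (m < 4)%N -> (nth 0%N l m < 4)%N by move=> hm; apply/ltl/mem_nth; rewrite sl.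
  rewrite !inordK ?lt //= => /eqP; rewrite nth_uniq ?sl // => /eqP; exact: val_inj.
by rewrite -pvalE /insubd insubT /= ffunE.
Qed.

Lemma nth_code l i : l \in codes -> (i < 4)%N -> (nth 0%N l i < 4)%N.
Proof. by move=> /codesP[sl _ ltl] hi; apply/ltl/mem_nth; rewrite sl. Qed.

Lemma comp_code_in l m : l \in codes -> m \in codes -> comp_code l m \in codes.
Proof.
have : all (fun l => all (fun m => comp_code l m \in codes) codes) codes by vm_compute.
by move=> /allP H /H /allP; apply.
Qed.

Lemma perm_of_comp l m : l \in codes -> m \in codes ->
  perm_of (comp_code l m) = (perm_of l * perm_of m)%g.
Proof.
move=> hl hm; apply/permP => i; rewrite permM !perm_ofE ?comp_code_in //.
by rewrite inordK ?nth_code // (nth_map 0%N) //; case/codesP: hl => ->.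
Qed.

Lemma perm_of1 : perm_of (iota 0 4) = 1%g.
Proof.
apply/permP => i; rewrite perm_ofE //.
by rewrite nth_iota // add0n inord_val perm1.
Qed.

Lemma code_ofP s : code_of s \in codes /\ perm_of (code_of s) = s.
Proof.
have inc : code_of s \in codes.
  rewrite mem_permutations; apply: uniq_perm; rewrite ?iota_uniq //.
    by rewrite map_inj_uniq ?enum_uniq // => i j /val_inj /perm_inj.
  move=> x; rewrite mem_iota /=; apply/mapP/idP => [[i _ ->]|hx]; first exact: ltn_ord.
  exists ((s^-1)%g (Ordinal hx)); first by rewrite mem_enum.
  by rewrite permKV.
split=> //; apply/permP => i; rewrite perm_ofE // (nth_map i) ?size_enum_ord //.
by rewrite nth_ord_enum inord_val.
Qed.

Lemma perm_of_inj l m : l \in codes -> m \in codes -> perm_of l = perm_of m -> l = m.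
Proof.
move=> hl hm E; have [sl _ _] := codesP hl; have [sm _ _] := codesP hm.
apply: (@eq_from_nth _ 0%N); rewrite ?sl ?sm // => i hi.
have /(congr1 (fun s : 'S_4 => nat_of_ord (s (inord i)))) := E.
by rewrite !perm_ofE // !inordK ?nth_code.
Qed.

Definition lists_codes (L : seq code) (M : {set 'S_4}) :=
  [/\ {subset L <= codes}, uniq L & forall l, l \in codes -> (perm_of l \in M) = (l \in L)].

Lemma perm_eq_enum L M : lists_codes L M -> perm_eq (map perm_of L) (enum M).
Proof.
move=> [Lc uL HL]; apply: uniq_perm; rewrite ?enum_uniq //.
  by rewrite map_inj_in_uniq // => l m /Lc hl /Lc hm; apply: perm_of_inj.
move=> s; have [hs Es] := code_ofP s; rewrite mem_enum -{2}Es HL //.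
apply/mapP/idP => [[l hl E]|h]; last by exists (code_of s).
by rewrite (_ : code_of s = l) //; apply: perm_of_inj => //; [apply: Lc|rewrite Es].
Qed.

Lemma card_codes L M : lists_codes L M -> #|M| = size L.
Proof. by move=> /perm_eq_enum/perm_size; rewrite size_map -cardE. Qed.

Section Evaluation.
Variables (J : zmodType) (rho : 'S_4 -> {additive J -> J}).
Hypothesis rho1 : forall a, rho 1%g a = a.
Hypothesis rhoM : forall s t a, rho (s * t)%g a = rho t (rho s a).

Definition gev (x : gring) (a : J) : J :=
  \sum_(p <- x) rho (perm_of p.2) a *~ int_of_Z p.1.

Lemma gevB x a b : gev x (a - b) = gev x a - gev x b.
Proof. by rewrite /gev -sumrB; apply: eq_bigr => p _; rewrite raddfB /= mulrzBl. Qed.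
Lemma gevD x a b : gev x (a + b) = gev x a + gev x b.
Proof. by rewrite /gev -big_split; apply: eq_bigr => p _; rewrite raddfD /= mulrzDl. Qed.
Lemma gev0 x : gev x 0 = 0.
Proof. by have := gevB x 0 0; rewrite !subrr. Qed.
Lemma gevMz x a (n : int) : gev x (a *~ n) = gev x a *~ n.
Proof.
rewrite /gev mulrz_suml; apply: eq_bigr => p _.
by rewrite raddfMz /= -mulrzA mulrC mulrzA.
Qed.
Lemma gev_sum x (I : Type) (r : seq I) (F : I -> J) :
  gev x (\sum_(i <- r) F i) = \sum_(i <- r) gev x (F i).
Proof. by elim: r => [|i r IH]; rewrite ?big_nil ?gev0 // !big_cons gevD IH. Qed.

(** Well-formedness matters because [gnorm] discards every term whose list is not a permutation. *)
Lemma gev_norm x a : gwf x -> gev (gnorm x) a = gev x a.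
Proof.
have u : uniq codes by apply: permutations_uniq.
elim: x => [_|[c l] x IH].
  by rewrite /gev big_nil big_map big1 // => l _; rewrite /gcoef /= mulr0z.
case/andP=> /= hl hx; rewrite {2}/gev big_cons -/(gev x a) -IH //= /gev !big_map.
rewrite [in LHS](bigD1_seq l) //= [in RHS](bigD1_seq l) //= eqxx addrA.
congr (_ + _); first by rewrite rmorphD /= mulrzDr.
by apply: eq_bigr => m; rewrite eq_sym => /negbTE ->.
Qed.

Lemma gwf_norm x : gwf (gnorm x).
Proof. by apply/allP => p /mapP[l hl ->]. Qed.
Lemma gwf_cat x y : gwf x -> gwf y -> gwf (x ++ y).
Proof. by move=> hx hy; rewrite /gwf all_cat; apply/andP. Qed.

Lemma gev_add x y a : gwf x -> gwf y -> gev (gadd x y) a = gev x a + gev y a.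
Proof. by move=> hx hy; rewrite gev_norm ?gwf_cat // /gev big_cat. Qed.

Lemma gev_mul x y a : gwf x -> gwf y -> gev (gmul x y) a = gev x (gev y a).
Proof.
move=> /allP hx /allP hy; rewrite gev_norm.
  rewrite /gev big_allpairs_dep /= [in LHS]big_seq [in RHS]big_seq; apply: eq_bigr => p /hx hp.
  rewrite raddf_sum /= mulrz_suml [in LHS]big_seq [in RHS]big_seq.
  apply: eq_bigr => q /hy hq; rewrite perm_of_comp // rhoM rmorphM /=.
  by rewrite raddfMz /= -mulrzA mulrC.
apply/allP => _ /allpairsP[[p q] [/= hp hq ->]]; apply: comp_code_in; [exact: hy|exact: hx].
Qed.

Lemma gev_scale c x a : gev (gscale c x) a = gev x a *~ int_of_Z c.
Proof.
rewrite /gev big_map mulrz_suml; apply: eq_bigr => p _.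
by rewrite rmorphM /= mulrC mulrzA.
Qed.

Lemma gev_elt l a : l \in codes -> gev (gelt l) a = rho (perm_of l) a.
Proof. by move=> hl; rewrite gev_norm /= ?andbT // /gev big_seq1 mulr1z. Qed.

Lemma gev_one a : gev gone a = a.
Proof. by rewrite gev_elt ?perm_of1 ?rho1 // mem_permutations. Qed.

Lemma gev_set (M : {set 'S_4}) (L : seq code) a : lists_codes L M ->
  gev (gset L) a = \sum_(s in M) rho s a.
Proof.
move=> HL; have [Lc _ _] := HL; rewrite gev_norm; last by apply/allP => _ /mapP[l /Lc hl ->].
rewrite /gev big_map /=; under eq_bigr do rewrite mulr1z.
rewrite -(big_map perm_of xpredT (fun s => rho s a)) -big_enum /=.
by apply: perm_big; apply: perm_eq_enum.
Qed.
End Evaluation.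

(** * The subgroups of S_4 as explicit lists *)

Definition code1 : code := [:: 0; 1; 2; 3]%N.
Definition code13 : code := [:: 2; 1; 0; 3]%N.
Definition code1234 : code := [:: 1; 2; 3; 0]%N.
Definition code12 : code := [:: 1; 0; 2; 3]%N.
Definition square_code (l : code) := comp_code l l.
(* Every element of A_4 is a product of two squares. *)
Definition codesA4 : seq code := 
  undup [seq comp_code (square_code l) (square_code m) | l <- codes, m <- codes].
Definition codesS3 : seq code := [seq l <- codes | nth 0%N l 0 == 0%N].
Definition word (w : seq code) : code := foldr comp_code code1 w.
Definition wordsZ := [seq nseq i code1234 | i <- iota 0 4].
Definition wordsD4 := wordsZ ++ [seq code13 :: w | w <- wordsZ].
Definition codesZ : seq code := map word wordsZ.
Definition codesD4 : seq code := map word wordsD4.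

Lemma code_of_perm l : l \in codes -> code_of (perm_of l) = l.
Proof. by move=> hl; have [hc E] := code_ofP (perm_of l); apply: perm_of_inj. Qed.

Lemma code_of_mul s t : code_of (s * t)%g = comp_code (code_of s) (code_of t).
Proof.
have [hs Es] := code_ofP s; have [ht Et] := code_ofP t.
by rewrite -{1}Es -{1}Et -perm_of_comp // code_of_perm // comp_code_in.
Qed.

Lemma perm13E : perm13 = perm_of code13.
Proof.
apply/permP => i; rewrite perm_ofE // /perm13.
case: tpermP => [->|->|]; rewrite ?inordK //.
by case: i => -[|[|[|[|//]]]] hi h0 h2; rewrite /=;
  [case: h0| |case: h2|]; apply: val_inj; rewrite /= inordK.
Qed.

Lemma perm1234E : perm1234 = perm_of code1234.
Proof.
apply/permP => i; rewrite perm_ofE // /perm1234 permE; apply: val_inj.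
by case: i => -[|[|[|[|//]]]] hi; rewrite /= inordK.
Qed.

(** The values of the words are products of generators; conversely they contain the generators and
    are closed under composition, hence form a subgroup of the finite group S_4. *)
Lemma mem_gen_codes (A : {set 'S_4}) (gens : seq code) (words : seq (seq code)) :
  all (fun g => g \in codes) gens -> (forall g, g \in gens -> perm_of g \in A) ->
  (forall s, s \in A -> code_of s \in gens) ->
  all (fun w => all (fun l => l \in gens) w) words ->
  code1 \in map word words -> all (fun g => g \in map word words) gens ->
  all (fun l => all (fun m => comp_code l m \in map word words) (map word words))
    (map word words) ->
  forall l, l \in codes -> (perm_of l \in <<A>>%g) = (l \in map word words).
Proof.
move=> /allP gc gA Ag ww h1 /allP gw /allP closed l hl; apply/idP/idP; last first.
  move=> /mapP[w /(allP ww) hw ->]; elim: w hw => [|g w IH] /=.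
    by rewrite -/(iota 0 4) perm_of1 group1.
  case/andP=> hg hw; have wc : word w \in codes.
    by elim: w hw {IH} => //= k w IH /andP[/gc hk /IH]; apply: comp_code_in.
  rewrite perm_of_comp ?(gc _ hg) //.
  by apply: (@groupM _ <<A>>%G); [apply: mem_gen; apply: gA|apply: IH].
pose H := [set s | code_of s \in map word words].
have gH : group_set H.
  apply/group_setP; split.
    by rewrite inE -perm_of1 code_of_perm.
  by move=> s t; rewrite !inE code_of_mul => /closed/allP; apply.
have : (<<A>> \subset Group gH)%g.
  by rewrite gen_subG; apply/fintype.subsetP => s /Ag hs; rewrite inE; apply: gw.
move=> /fintype.subsetP/(_ (perm_of l)) Hl /Hl.
by rewrite inE code_of_perm.
Qed.

Lemma mem_grpD4 l : l \in codes -> (perm_of l \in grpD4) = (l \in codesD4).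
Proof.
apply: (@mem_gen_codes [set perm13; perm1234]%SET [:: code13; code1234]) => //.
- by move=> g; rewrite !inE perm13E perm1234E => /orP[] /eqP ->; rewrite eqxx ?orbT.
- by move=> s; rewrite !inE perm13E perm1234E => /orP[] /eqP ->; rewrite code_of_perm ?eqxx ?orbT.
Qed.

Lemma mem_grpZ l : l \in codes -> (perm_of l \in grpZ) = (l \in codesZ).
Proof.
apply: (@mem_gen_codes [set perm1234]%SET [:: code1234]) => //.
- by move=> g; rewrite !inE perm1234E => /eqP ->.
- by move=> s; rewrite !inE perm1234E => /eqP ->; rewrite code_of_perm.
Qed.

Lemma mem_grpS4 l : l \in codes -> (perm_of l \in grpS4) = (l \in codes).
Proof. by move=> ->; rewrite inE. Qed.

Lemma mem_grpS3 l : l \in codes -> (perm_of l \in grpS3) = (l \in codesS3).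
Proof.
move=> hl; rewrite mem_filter hl andbT.
apply/(astab1P)/eqP => /=; rewrite /aperm perm_ofE // inordK //.
  by move=> /(congr1 (@nat_of_ord 4)); rewrite !inordK ?nth_code.
by move=> ->.
Qed.

Lemma mem_grpA4 l : l \in codes -> (perm_of l \in grpA4) = (l \in codesA4).
Proof.
have even m : m \in codesA4 -> ~~ odd_perm (perm_of m).
  rewrite mem_undup => /allpairsP[[p q] [/= hp hq ->]].
  rewrite !perm_of_comp ?comp_code_in // !odd_permM !addbb //.
move=> hl; rewrite Alt_even; apply/idP/idP; last exact: even.
(* Outside the list, composing with the transposition (12) leads into the list, whose elements are
   even; so such a permutation is odd. *)
apply: contraNT => nl.
have hl' : comp_code l code12 \in codesA4.
  have /allP/(_ l hl) : all (fun l => (l \in codesA4) || (comp_code l code12 \in codesA4)) codes.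
    by vm_compute.
  by rewrite (negbTE nl).
move: (even _ hl') => {hl' nl even}; rewrite perm_of_comp // odd_permM.
have -> : perm_of code12 = tperm (inord 0) (inord 1).
  apply/permP => i; rewrite perm_ofE //.
  case: tpermP => [->|->|]; rewrite ?inordK //.
  by case: i => -[|[|[|[|//]]]] hi h0 h2; rewrite /=;
    [case: h0|case: h2| |]; apply: val_inj; rewrite /= inordK.
by rewrite odd_tperm -val_eqE /= !inordK //= addbT negbK.
Qed.

(* The map JX -> P(X_M / X_N) is given by the codes of M, the element
   |N| - N_N of Z[S_4] (just 1 for the map JX -> JY), and the element of S_4
   precomposed with it. *)
Record component_data := ComponentData { cd_codes : seq code; cd_mul : gring; cd_shift : code }.

Definition diff_norm (c : Z) (L : seq code) : gring := gadd (gscale c gone) (gscale (-1) (gset L)).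

(** The constants 24 and 8 are the orders of S_4 and D_4. The shifts carry M to distinct conjugates,
    chosen so that the lines they fix form a basis of the representation concerned: two of the three
    lines in V, three of the four in W, and all three in W tensor sign. *)
Definition components : seq component_data :=
  let q := diff_norm 24%coqZ codes in
  [:: ComponentData codes gone code1;
      ComponentData codesA4 q code1;
      ComponentData codesD4 q code1;
      ComponentData codesD4 q [:: 0; 1; 3; 2]%N;
      ComponentData codesS3 q code1;
      ComponentData codesS3 q [:: 1; 0; 2; 3]%N;
      ComponentData codesS3 q [:: 1; 2; 0; 3]%N;
      ComponentData codesZ (diff_norm 8%coqZ codesD4) code1;
      ComponentData codesZ (diff_norm 8%coqZ codesD4) [:: 0; 1; 3; 2]%N;
      ComponentData codesZ (diff_norm 8%coqZ codesD4) [:: 0; 2; 1; 3]%N ].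

Definition comp_op (d : component_data) : gring := gmul (gset (cd_codes d)) (cd_mul d).
Definition comp_row (d : component_data) : gring := gmul (comp_op d) (gelt (cd_shift d)).
(** If [comp_op] acts as a multiple of the projector e e^T, with e a unit vector, and the inverse
    shift moves e to e_i, then [comp_row] is that multiple of e e_i^T and [comp_col] of e_i e^T. A
    row times a column is thus a Gram coefficient times [comp_op], up to the factor |M| |N| (24 for
    the first component). *)
Definition comp_col (d : component_data) : gring := gmul (gelt (inv_code (cd_shift d))) (comp_op d).

(* Inverse Gram matrix of the lines fixed by the conjugate subgroups in each
   irreducible representation, scaled to be integral. *)
Definition dual_coefs : seq (seq Z) := [::
  [:: 24; 0; 0; 0; 0; 0; 0; 0; 0; 0];
  [:: 0; 2; 0; 0; 0; 0; 0; 0; 0; 0];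
  [:: 0; 0; 4; 2; 0; 0; 0; 0; 0; 0];
  [:: 0; 0; 2; 4; 0; 0; 0; 0; 0; 0];
  [:: 0; 0; 0; 0; 6; 3; 3; 0; 0; 0];
  [:: 0; 0; 0; 0; 3; 6; 3; 0; 0; 0];
  [:: 0; 0; 0; 0; 3; 3; 6; 0; 0; 0];
  [:: 0; 0; 0; 0; 0; 0; 0; 18; 0; 0];
  [:: 0; 0; 0; 0; 0; 0; 0; 0; 18; 0];
  [:: 0; 0; 0; 0; 0; 0; 0; 0; 0; 18] ]%coqZ.

Definition gsum (s : seq gring) : gring := foldr gadd (gnorm [::]) s.

Definition duals : seq gring :=
  [seq gsum [seq gscale p.1 (comp_col p.2) | p <- zip cs components] | cs <- dual_coefs].

(* 576 / (|M| |N|): the element N_M (|N| - N_N) is |M| |N| times an idempotent. *)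
Definition dual_weights : seq Z := [:: 24; 2; 3; 3; 4; 4; 4; 18; 18; 18]%coqZ.

(** Biorthogonality: multiplying rows by duals produces the Gram matrix times its scaled inverse,
    hence 576 on the diagonal and 0 elsewhere, including across different representations. *)
Definition dual_rows (rows ops ds : seq gring) : bool :=
  all (fun i => all (fun j => gmul (nth [::] rows i) (nth [::] ds j) ==
      if i == j then gnorm (gscale 576%coqZ (nth [::] ops i)) else gnorm [::])
    (iota 0 10)) (iota 0 10).

Lemma row_dual : dual_rows (map comp_row components) (map comp_op components) duals.
Proof. by vm_compute. Qed.

Definition sum_dual_rows (rows ds : seq gring) : gring :=
  gsum [seq gscale (nth 0 dual_weights i) (gmul (nth [::] ds i) (nth [::] rows i))
       | i <- iota 0 10].

(** Completeness: in each irreducible representation the sum of e_k e_i^T against the inverse Gram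
    matrix is the identity. The factor |M| |N| occurs squared, the weight 576 / (|M| |N|) once in
    [dual_coefs] and once in the sum, whence 331776 = 576 ^ 2. *)
Lemma dual_row :
  sum_dual_rows (map comp_row components) duals = gnorm (gscale 331776%coqZ gone).
Proof. by vm_compute. Qed.

Section Decomposition.
Variables (J : zmodType) (rho : 'S_4 -> {additive J -> J}).
Hypothesis rho1 : forall a, rho 1%g a = a.
Hypothesis rhoM : forall s t a, rho (s * t)%g a = rho t (rho s a).
Local Notation gev := (gev rho).

Definition op_at i := nth [::] (map comp_op components) i.
Definition shift_at i := perm_of (nth code1 (map cd_shift components) i).

Lemma mulrz_posZ (p : positive) (a : J) :
  a *~ int_of_Z (Zpos p) = a *+ Pos.to_nat p.
Proof. by []. Qed.

Lemma gwf_row i : (i < 10)%N -> gwf (nth [::] (map comp_row components) i).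
Proof. by do 10?[case: i => [_|i]; first exact: gwf_norm]. Qed.

Lemma gwf_dual i : (i < 10)%N -> gwf (nth [::] duals i).
Proof. by do 10?[case: i => [_|i]; first exact: gwf_norm]. Qed.

Lemma gwf_op i : (i < 10)%N -> gwf (op_at i).
Proof. by do 10?[case: i => [_|i]; first exact: gwf_norm]. Qed.

Lemma gev_comp_row d a : cd_shift d \in codes ->
  gev (comp_row d) a = gev (comp_op d) (rho (perm_of (cd_shift d)) a).
Proof.
by move=> hd; rewrite /comp_row (gev_mul rhoM) ?(gev_elt _ _ hd) //; apply: gwf_norm.
Qed.

Lemma gev_row i a : (i < 10)%N ->
  gev (nth [::] (map comp_row components) i) a = gev (op_at i) (rho (shift_at i) a).
Proof.
move=> hi; pose d0 := ComponentData [::] [::] code1.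
have hsz : (i < size components)%N by [].
have hd : cd_shift (nth d0 components i) \in codes.
  have /(all_nthP d0)/(_ i hsz) : all (fun d => cd_shift d \in codes) components by [].
  exact.
have E := gev_comp_row a hd.
rewrite -(nth_map d0 code1 cd_shift hsz) in E.
apply: (etrans (congr1 (gev^~ a) (nth_map d0 [::] comp_row hsz))).
exact: (etrans E (congr1 (gev^~ _) (esym (nth_map d0 [::] comp_op hsz)))).
Qed.

Lemma gev_gsum (s : seq gring) a : all gwf s ->
  gev (gsum s) a = \sum_(x <- s) gev x a.
Proof.
elim: s => [_|x s IH] /=.
  rewrite big_nil /gev big_map big1 // => l _; by rewrite mulr0z.
case/andP=> hx hs; rewrite big_cons gev_add // ?IH //.
by case: s {IH hs} => [|y s]; apply: gwf_norm.
Qed.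

Lemma gwf_scale c x : gwf (gscale c x) = gwf x.
Proof. by rewrite /gwf all_map. Qed.

Lemma decomposition_injective : exists2 K, (0 < K)%N &
  forall a, (forall i, (i < 10)%N -> gev (op_at i) (rho (shift_at i) a) = 0) -> a *+ K = 0.
Proof.
exists (Pos.to_nat 331776); first by apply/ssrnat.ltP/Pos2Nat.is_pos.
move=> a Ha; rewrite -mulrz_posZ -[a](gev_one rho1) -gev_scale -gev_norm;
  last by rewrite gwf_scale gwf_norm.
rewrite -dual_row /sum_dual_rows gev_gsum; last first.
  by apply/allP => _ /mapP[i _ ->]; rewrite gwf_scale gwf_norm.
rewrite big_map big_seq big1 // => i i_iota.
have hi : (i < 10)%N by rewrite mem_iota in i_iota.
rewrite gev_scale (gev_mul rhoM) ?gwf_row ?gwf_dual // gev_row // Ha //.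
by rewrite gev0 mul0rz.
Qed.

(** By biorthogonality the sum of the dual_j (b j) has the required components, with L = 576. The
    conclusion is the vanishing of an operator on a difference because the maps to the Prym
    varieties are known only through the kernels of these operators. *)
Lemma decomposition_surjective : exists2 L, (0 < L)%N &
  forall b : nat -> J, exists a, forall i, (i < 10)%N ->
    gev (op_at i) (rho (shift_at i) a - b i *+ L) = 0.
Proof.
exists (Pos.to_nat 576); first by apply/ssrnat.ltP/Pos2Nat.is_pos.
move=> b; exists (\sum_(j <- iota 0 10) gev (nth [::] duals j) (b j)) => i hi.
have e : gev (op_at i) (b i *+ Pos.to_nat 576) = gev (gnorm (gscale 576%coqZ (op_at i))) (b i).
  rewrite gev_norm; last by rewrite gwf_scale; apply: gwf_op.
  by rewrite gev_scale -mulrz_posZ gevMz.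
rewrite gevB e -(gev_row _ hi) gev_sum.
have hrd j : j \in iota 0 10 ->
    gev (nth [::] (map comp_row components) i) (gev (nth [::] duals j) (b j)) =
    gev (if i == j then gnorm (gscale 576%coqZ (op_at i)) else gnorm [::]) (b j).
  move=> hj; have hj' : (j < 10)%N by move: hj; rewrite mem_iota.
  rewrite -gev_mul ?gwf_row ?gwf_dual //.
  have /allP/(_ i) := row_dual; rewrite mem_iota => /(_ hi) /allP/(_ j hj) /eqP ->.
  by [].
rewrite big_seq (eq_bigr _ hrd) -big_seq (bigD1_seq i) ?mem_iota ?iota_uniq //= eqxx.
rewrite big1 ?addr0 ?subrr // => j; rewrite eq_sym => /negbTE ->.
by rewrite /gev big_map big1 // => l _; rewrite mulr0z.
Qed.
End Decomposition.

Local Open Scope classical_set_scope.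

(** * Projective varieties and their charts *)

Section Spaces.
Variable R : realType.
Local Notation C := R[i].

(** The axioms of a topology with a sheaf of functions in which nonvanishing functions are
    invertible. An [fstruct] is bare data, so they have to be derived for projective varieties. *)
Record function_space T (S : fstruct R T) : Prop := FunctionSpace {
  fs_openT : fn_open S setT;
  fs_open_local : forall U, (forall x, U x -> exists V, [/\ fn_open S V, V x & V `<=` U]) ->
    fn_open S U;
  fs_openI : forall U V, fn_open S U -> fn_open S V -> fn_open S (U `&` V);
  fs_local : forall U f, fn_open S U ->
    (forall x, U x -> exists V g, [/\ fn_open S V, V x, fn_regular S V g &
       forall y, U y -> V y -> f y = g y]) -> fn_regular S U f;
  fs_cst : forall U a, fn_open S U -> fn_regular S U (fun=> a);
  fs_add : forall U f g, fn_open S U -> fn_regular S U f -> fn_regular S U g ->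
    fn_regular S U (fun x => f x + g x);
  fs_mul : forall U f g, fn_open S U -> fn_regular S U f -> fn_regular S U g ->
    fn_regular S U (fun x => f x * g x);
  fs_inv : forall U f, fn_open S U -> fn_regular S U f ->
    fn_open S [set x | U x /\ f x != 0] /\
    fn_regular S [set x | U x /\ f x != 0] (fun x => (f x)^-1) }.

Definition homogeneous n (p : {mpoly C[n]}) := exists d, p \is d.-homog.

Lemma homogeneousM n (p q : {mpoly C[n]}) :
  homogeneous p -> homogeneous q -> homogeneous (p * q).
Proof. by move=> [d hp] [e hq]; exists (d + e)%N; apply: dhomogM. Qed.

Lemma dhomog_eval n d (p : {mpoly C[n]}) (t : C) (v : 'I_n -> C) :
  p \is d.-homog -> p.@[fun i => t * v i] = t ^+ d * p.@[v].
Proof.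
move=> /dhomogP hp; rewrite !mevalE mulr_sumr; rewrite big_seq [RHS]big_seq.
apply: eq_bigr => m /hp <-; rewrite mulrCA; congr (_ * _).
under eq_bigr do rewrite exprMn.
by rewrite big_split /= prodrXr mdegE.
Qed.

Lemma homogeneous_eval_eq0 n (p : {mpoly C[n]}) (t : C) (v : 'I_n -> C) :
  homogeneous p -> t != 0 -> (p.@[fun i => t * v i] == 0) = (p.@[v] == 0).
Proof.
by move=> [d hp] t0; rewrite (dhomog_eval _ _ hp) mulf_eq0 expf_eq0 (negbTE t0) andbF.
Qed.

(** Projectivity pulled back to T itself: closedness, open sets and regular functions are all read
    off from homogeneous polynomials along [iota], without the subtype in [sub_struct]. *)
Record embedded T (S : fstruct R T) n (iota : T -> pspace R n) : Prop := Embedded {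
  emb_inj : injective iota;
  emb_closed : exists P : set {mpoly C[n.+1]},
    (forall p, P p -> homogeneous p) /\
    forall z, (exists y, iota y = z) <-> forall p, P p -> peval p z = 0;
  emb_open : forall U, fn_open S U <-> forall x, U x -> exists p,
    [/\ homogeneous p, peval p (iota x) != 0 & forall y, peval p (iota y) != 0 -> U y];
  emb_regular : forall U f, fn_open S U -> (fn_regular S U f <->
    forall x, U x -> exists d (p q : {mpoly C[n.+1]}) V,
      [/\ p \is d.-homog, q \is d.-homog, fn_open S V, V x &
        forall y, U y -> V y ->
          peval q (iota y) != 0 /\ f y = peval p (iota y) / peval q (iota y)]) }.

Lemma pevalM n (p q : {mpoly C[n.+1]}) (x : pspace R n) :
  peval (p * q) x = peval p x * peval q x.
Proof. by rewrite /peval rmorphM. Qed.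
Lemma pevalD n (p q : {mpoly C[n.+1]}) (x : pspace R n) :
  peval (p + q) x = peval p x + peval q x.
Proof. by rewrite /peval rmorphD. Qed.
Lemma pevalC n (c : C) (x : pspace R n) : peval c%:MP x = c.
Proof. by rewrite /peval mevalC. Qed.

Lemma projective_embedded T (S : fstruct R T) : projective S ->
  exists n (iota : T -> pspace R n), embedded S iota.
Proof.
move=> [n [Z [iota [[P hP ZP] [k [morph_k [g [morph_g kg gk]]] Ek]]]]].
exists n, iota.
have opS U : fn_open S U <-> forall x, U x -> exists p,
    [/\ homogeneous p, peval p (iota x) != 0 & forall y, peval p (iota y) != 0 -> U y].
  split=> [oU x Ux|H].
    have [[V [Q hQ VQ] EV] _] := morph_g U oU.
    have : (g @^-1` U) (k x) by rewrite /= kg.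
    rewrite EV /= VQ /= => -[p Qp px]; exists p; split; [exact: hQ|by rewrite Ek|].
    move=> y py; have : (g @^-1` U) (k y) by rewrite EV /= VQ /=; exists p => //; rewrite -Ek.
    by rewrite /= kg.
  pose Q := [set p | homogeneous p /\ forall y, peval p (iota y) != 0 -> U y].
  pose V := [set z : pspace R n | exists2 p, Q p & peval p z != 0].
  have [|oV _] := morph_k [set z | V (val z)].
    by exists V => //; exists Q => // p [].
  have <- // : k @^-1` [set z | V (val z)] = U.
  apply/seteqP; split=> x /=; first by rewrite -Ek => -[p [_]]; apply.
  by move=> /H [p [hp px Hp]]; exists p => //; rewrite -Ek.
split.
- move=> x y exy; apply: (can_inj kg); apply: val_inj; by rewrite -!Ek.
- exists P; split=> [p /hP //|z].
  have -> : (forall p, P p -> peval p z = 0) <-> Z z.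
    split=> [H|Zz p Pp].
      apply: contrapT => nZ; have : (~` Z) z by [].
      by rewrite ZP /= => -[p /H ->]; rewrite eqxx.
    apply/eqP/negPn/negP => pz; suff : (~` Z) z by [].
    by rewrite ZP /=; exists p.
  split=> [[y <-]|Zz]; first by rewrite Ek; apply: set_valP.
  by exists (g (exist _ z (mem_set Zz))); rewrite Ek gk.
- exact: opS.
move=> U f oU; split=> [rf x Ux|H].
  have [oV Hr] := morph_g U oU; have := Hr f rf (k x); rewrite /= kg => /(_ Ux).
  move=> [V [h [oV' Vx rh Hh]]].
  have [V' [d [p [q [oV'' V'x hp hq Hpq]]]]] := rh _ Vx.
  exists d, p, q, [set y | V (iota y) /\ V' (iota y)]; split => //.
  - apply/opS => y [Vy V'y]; case: oV' Vy => Q hQ -> /= [r Qr ry].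
    case: oV'' V'y => Q' hQ' -> /= [r' Qr' ry'].
    exists (r * r'); split; first by apply: homogeneousM; [apply: hQ|apply: hQ'].
      by rewrite pevalM mulf_neq0.
    move=> z; rewrite pevalM mulf_eq0 negb_or => /andP[rz rz'].
    by split; [exists r|exists r'].
  - by rewrite /= Ek.
  move=> y Uy [Vy V'y]; have := Hh (k y); rewrite /= kg -Ek => -> //.
  exact: Hpq.
have [_ Hk] := morph_k (g @^-1` U) (morph_g U oU).1.
suff : fn_regular (sub_struct (pspace_struct R n) Z) (g @^-1` U) (f \o g).
  move=> /Hk; have -> : (f \o g) \o k = f by apply/funext => x /=; rewrite kg.
  by have -> // : k @^-1` (g @^-1` U) = U; apply/seteqP; split=> x /=; rewrite kg.
move=> z Uz; have [d [p [q [V [hp hq oV Vz Hpq]]]]] := H _ Uz.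
have [r [hr rz Hr]] := (opS V).1 oV _ Vz.
have [s [hs sz Hs]] := (opS U).1 oU _ Uz.
have [qz _] := Hpq _ Uz Vz.
(* A regular function on the subspace must extend locally to an open set W of the ambient projective
   space. The factor q makes the fraction regular on all of W, and r keeps the points of Z in W
   inside V. *)
have hW : homogeneous (r * s * q) 
  by apply: homogeneousM; [apply: homogeneousM|exists d].
pose W := [set z : pspace R n | peval (r * s * q) z != 0].
have oW : pspace_open W.
  exists [set r * s * q] => [_ -> //|].
  by apply/seteqP; split=> y /=; [exists (r * s * q)|move=> [_ ->]].
exists W, (fun z => peval p z / peval q z); split => //.
- by rewrite /W /= !pevalM -[z]gk -Ek !mulf_neq0.
- move=> x Wx; exists W, d, p, q; split=> // y _; rewrite /W /= pevalM.
  by rewrite mulf_eq0 negb_or => /andP[_].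
move=> y Uy; rewrite /W /= !pevalM !mulf_eq0 !negb_or => /andP[/andP[ry sy] qy].
have [] := Hpq (g y) Uy; first by apply: Hr; rewrite Ek gk.
by rewrite Ek gk.
Qed.

Lemma embedded_function_space T (S : fstruct R T) n (iota : T -> pspace R n) :
  embedded S iota -> function_space S.
Proof.
move=> E; have op := emb_open E.
have loc U : (forall x, U x -> exists V, [/\ fn_open S V, V x & V `<=` U]) -> fn_open S U.
  move=> H; apply/op => x /H [V [/op oV Vx VU]]; have [p [hp px Hp]] := oV _ Vx.
  by exists p; split=> // y /Hp /VU.
have opI U V : fn_open S U -> fn_open S V -> fn_open S (U `&` V).
  move=> /op oU /op oV; apply/op => x [/oU[p [hp px Hp]] /oV[q [hq qx Hq]]].
  exists (p * q); split; first exact: homogeneousM.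
    by rewrite pevalM mulf_neq0.
  by move=> y; rewrite pevalM mulf_eq0 negb_or => /andP[/Hp ? /Hq].
have opT : fn_open S setT.
  apply/op => x _; exists 1; split=> //; first by exists 0%N; apply: dhomog1.
  by rewrite /peval rmorph1 oner_eq0.
split=> //.
- move=> U f oU H; apply/(emb_regular E) => // x Ux.
  have [V [g [oV Vx rg Hg]]] := H x Ux.
  have [d [p [q [W [hp hq oW Wx Hpq]]]]] := (emb_regular E _ oV).1 rg _ Vx.
  exists d, p, q, (V `&` W); split=> //; first exact: opI.
  by move=> y Uy [Vy Wy]; rewrite Hg //; apply: Hpq.
- move=> U a oU; apply/(emb_regular E) => // x Ux.
  exists 0%N, a%:MP, 1, U; split=> //; rewrite ?dhomog1 //.
    by rewrite -[a%:MP]mulr1 mul_mpolyC; apply/dhomogZ/dhomog1.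
  by move=> y _ _; rewrite pevalC /peval rmorph1 oner_eq0 divr1.
- move=> U f g oU /(emb_regular E f oU) rf /(emb_regular E g oU) rg.
  apply/(emb_regular E) => // x Ux.
  have [d [p [q [V [hp hq oV Vx Hpq]]]]] := rf _ Ux.
  have [d' [p' [q' [V' [hp' hq' oV' Vx' Hpq']]]]] := rg _ Ux.
  exists (d + d')%N, (p * q' + q * p'), (q * q'), (V `&` V'); split; try exact: dhomogM.
  - by apply: dhomogD; apply: dhomogM.
  - exact: opI.
  - by [].
  move=> y Uy [Vy Vy']; have [qy ->] := Hpq _ Uy Vy; have [qy' ->] := Hpq' _ Uy Vy'.
  by rewrite pevalD !pevalM mulf_neq0 // addf_div // [peval p' _ * _]mulrC.
- move=> U f g oU /(emb_regular E f oU) rf /(emb_regular E g oU) rg.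
  apply/(emb_regular E) => // x Ux.
  have [d [p [q [V [hp hq oV Vx Hpq]]]]] := rf _ Ux.
  have [d' [p' [q' [V' [hp' hq' oV' Vx' Hpq']]]]] := rg _ Ux.
  exists (d + d')%N, (p * p'), (q * q'), (V `&` V'); split; try exact: dhomogM.
  - exact: opI.
  - by [].
  move=> y Uy [Vy Vy']; have [qy ->] := Hpq _ Uy Vy; have [qy' ->] := Hpq' _ Uy Vy'.
  by rewrite !pevalM mulf_neq0 // mulf_div.
- move=> U f oU /(emb_regular E f oU) rf.
  have oU' : fn_open S [set x | U x /\ f x != 0].
    apply: loc => x [Ux fx]; have [d [p [q [V [hp hq oV Vx Hpq]]]]] := rf _ Ux.
    exists (U `&` V `&` [set y | peval p (iota y) != 0]); split.
    + apply: (opI); first exact: (opI).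
      by apply/op => y py; exists p; split=> //; exists d.
    + split=> //=; apply: contraNneq fx => px.
      by have [_ ->] := Hpq _ Ux Vx; rewrite px mul0r.
    + move=> y [[Uy Vy] /= py]; split=> //; have [qy ->] := Hpq _ Uy Vy.
      by rewrite mulf_neq0 // invr_eq0.
  split=> //; apply/(emb_regular E) => // x [Ux fx].
  have [d [p [q [V [hp hq oV Vx Hpq]]]]] := rf _ Ux.
  exists d, q, p, V; split=> // y [Uy fy] Vy; have [qy Ey] := Hpq _ Uy Vy.
  rewrite Ey invf_div; split=> //; apply: contraNneq fy => py.
  by rewrite Ey py mul0r.
Qed.

(** An affine chart: c embeds V in affine N-space with closed image, closedness being phrased
    through the polynomials vanishing on V. *)
Record chart T (S : fstruct R T) (N : nat) (c : 'I_N -> T -> C) (V : set T) : Prop := Chart {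
  chart_open : fn_open S V;
  chart_coord : forall i, fn_regular S V (c i);
  chart_inj : forall y z, V y -> V z -> (forall i, c i y = c i z) -> y = z;
  chart_closed : forall a : 'I_N -> C,
    (forall p : {mpoly C[N]}, (forall y, V y -> p.@[c^~ y] = 0) -> p.@[a] = 0) ->
    exists y, V y /\ forall i, a i = c i y;
  chart_basis : forall U x, fn_open S U -> U x -> V x -> exists p : {mpoly C[N]},
    p.@[c^~ x] != 0 /\ forall y, V y -> p.@[c^~ y] != 0 -> U y;
  chart_regular : forall f x, regular_at S x f -> V x -> exists (p q : {mpoly C[N]}) W,
    [/\ fn_open S W, W x & forall y, W y -> q.@[c^~ y] != 0 /\ f y = p.@[c^~ y] / q.@[c^~ y]] }.

Lemma normalizedP n (v : 'rV[C]_n.+1) : reflect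
  (exists i, v 0 i = 1 /\ forall j : 'I_n.+1, (j < i)%N -> v 0 j = 0) (normalized v).
Proof.
apply: (iffP existsP) => -[k]; last first.
  case=> vk Hk; exists k; rewrite vk eqxx.
  by apply/forallP => j; apply/implyP => jk; rewrite (Hk _ jk).
case/andP=> /eqP vk /forallP Hk; exists k; split=> // j jk.
by have /implyP/(_ jk)/eqP := Hk j.
Qed.

Lemma normalize n (v : 'rV[C]_n.+1) : v != 0 ->
  exists (z : pspace R n) (t : C), t != 0 /\ v = t *: val z.
Proof.
move=> v0; have [i0 i0P] : exists i, v 0 i != 0.
  apply/existsP; apply: contraNT v0; rewrite negb_exists => /forallP H.
  by apply/eqP/rowP => i; rewrite mxE; apply/eqP/negPn/H.
case: (@arg_minnP _ i0 (fun i => v 0 i != 0) val i0P) => i vi Hi.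
have nz : normalized ((v 0 i)^-1 *: v).
  apply/normalizedP; exists i; rewrite mxE mulVf //; split=> // j ji.
  rewrite mxE; have [->|/Hi] := eqVneq (v 0 j) 0; first by rewrite mulr0.
  by rewrite leqNgt ji.
by exists (Sub _ nz : pspace R n), (v 0 i); split=> //=; rewrite scalerA divff // scale1r.
Qed.

Lemma pspace_neq0 n (z : pspace R n) : exists i, val z 0 i != 0.
Proof. by case/normalizedP: (valP z) => i [zi _]; exists i; rewrite zi oner_eq0. Qed.

Lemma pspace_scale_inj n (y z : pspace R n) t : t != 0 -> val y = t *: val z -> y = z.
Proof.
move=> t0 E; apply: val_inj; rewrite E.
have [i [yi Hi]] := normalizedP _ (valP y); have [j [zj Hj]] := normalizedP _ (valP z).
have Ei k : val y 0 k = t * val z 0 k by rewrite E mxE.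
have eij : i = j.
  apply: val_inj; case: (ltngtP i j) => // H.
    by move: (Ei i); rewrite yi Hj // mulr0 => /eqP; rewrite oner_eq0.
  by move: (Ei j); rewrite Hi // zj mulr1 => /eqP; rewrite eq_sym (negbTE t0).
by move: (Ei i); rewrite yi eij zj mulr1 => <-; rewrite scale1r.
Qed.

(** The complement of a coordinate hyperplane x_j = 0 not containing the point, with coordinates x_i
    / x_j. The constant coordinate x_j / x_j is kept, so homogeneous polynomials can be evaluated
    without dehomogenizing. *)
Lemma embedded_chart T (S : fstruct R T) n (iota : T -> pspace R n) (x0 : T) :
  embedded S iota -> exists N (c : 'I_N -> T -> C) V, chart S c V /\ V x0.
Proof.
move=> E; have FS := embedded_function_space E.
have [j xj] := pspace_neq0 (iota x0).
pose co i y := val (iota y) 0 i; pose V := [set y | co j y != 0].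
pose c i y := co i y / co j y.
have pc (p : {mpoly C[n.+1]}) y : V y -> homogeneous p ->
    (p.@[c^~ y] == 0) = (peval p (iota y) == 0).
  move=> Vy hp; rewrite -(homogeneous_eval_eq0 _ hp (t := co j y)) //.
  congr (_ == 0); apply: meval_eq => i; by rewrite mulrC divfK.
have hX i : ('X_i : {mpoly C[n.+1]}) \is 1.-homog by rewrite dhomogX /= mdeg1.
have pX i y : peval 'X_i (iota y) = co i y by rewrite /peval mevalXU.
have oV : fn_open S V.
  by apply/(emb_open E) => y Vy; exists 'X_j; rewrite pX; split=> [|//|z]; [exists 1%N|rewrite pX].
exists n.+1, c, V; split=> //; split=> //.
- move=> i; apply/(emb_regular E) => // x Vx; exists 1%N, 'X_i, 'X_j, V.
  by split=> // y Vy _; rewrite !pX.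
- move=> y z Vy Vz H; apply/(emb_inj E)/(@pspace_scale_inj _ _ _ (co j y / co j z)).
    by rewrite mulf_neq0 // invr_eq0.
  apply/rowP => i; rewrite mxE; have := H i; rewrite /c -/(co i y) -/(co i z).
  move=> /(congr1 (fun t => t * co j y)); rewrite divfK // => ->.
  by rewrite mulrC mulrA mulrAC.
(* The polynomial X_j - 1 vanishes on V, so a is a nonzero vector and represents a point of
   projective space. *)
- move=> a Ha; have aj : a j = 1.
    have := Ha ('X_j - 1); rewrite rmorphB rmorph1 /= mevalXU => H; apply/eqP; rewrite -subr_eq0.
    apply/eqP/H => y Vy; rewrite rmorphB rmorph1 /= mevalXU /c divff // subrr //.
  pose v := \row_i a i.
  have v0 : v != 0 by apply/eqP => /rowP/(_ j); rewrite !mxE aj => /eqP; rewrite oner_eq0.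
  have [z [t [t0 Ez]]] := normalize v0.
  have az i : a i = t * val z 0 i by have /rowP/(_ i) := Ez; rewrite !mxE.
  have [P [hP HP]] := emb_closed E.
  have [y yz] : exists y, iota y = z.
    apply/HP => p Pp; apply/eqP; rewrite /peval -(homogeneous_eval_eq0 _ (hP _ Pp) t0).
    rewrite (meval_eq (v2 := a)); last by move=> i; rewrite az.
    apply/eqP/Ha => y Vy; apply/eqP; rewrite pc //; last exact: hP.
    by apply/eqP; apply: (HP (iota y)).1 => //; exists y.
  have Vy : V y.
    rewrite /V /= /co yz; apply: contraTneq (oner_neq0 C) => zj.
    by rewrite -aj az zj mulr0 eqxx.
  exists y; split=> // i; rewrite /c /co yz -[a i]divr1 -aj !az.
  by rewrite -mulf_div divff // mul1r.
- move=> U x /(emb_open E) oU Ux Vx; have [p [hp px Hp]] := oU _ Ux.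
  exists p; rewrite pc //; split=> // y Vy; rewrite pc //; exact: Hp.
- move=> f x [U [oU Ux rf]] Vx.
  have [d [p [q [W [hp hq oW Wx Hpq]]]]] := (emb_regular E _ oU).1 rf _ Ux.
  exists p, q, (U `&` W `&` V); split=> //; first by apply: fs_openI => //; apply: fs_openI.
  move=> y [[Uy Wy] Vy]; have [qy ->] := Hpq _ Uy Wy; rewrite pc //; last by exists d.
  split=> //.
  have sc r : r \is d.-homog -> peval r (iota y) = co j y ^+ d * r.@[c^~ y].
    by move=> hr; rewrite -(dhomog_eval _ _ hr); apply: meval_eq => i; rewrite mulrC divfK.
  by rewrite !sc // -mulf_div divff ?mul1r // expf_neq0.
Qed.
End Spaces.

(** * Regular functions and morphisms *)

Section FunctionSpaces.
Variable R : realType.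
Local Notation C := R[i].

Section Calculus.
Variables (T : Type) (S : fstruct R T) (FS : function_space S).

Lemma fs_sub U V f : fn_open S U -> U `<=` V -> fn_open S V -> fn_regular S V f ->
  fn_regular S U f.
Proof. by move=> oU UV oV rf; apply: fs_local => // x Ux; exists V, f; split=> //; apply: UV. Qed.

Lemma fs_sum U (I : Type) (r : seq I) (P : pred I) (F : I -> T -> C) : fn_open S U ->
  (forall i, fn_regular S U (F i)) -> fn_regular S U (fun x => \sum_(i <- r | P i) F i x).
Proof.
move=> oU H; elim: r => [|i r IH].
  by under [X in fn_regular _ _ X]eq_fun do rewrite big_nil; apply: fs_cst.
under [X in fn_regular _ _ X]eq_fun do rewrite big_cons.
by case: (P i) => //; apply: fs_add.
Qed.

Lemma fs_prod U (I : Type) (r : seq I) (P : pred I) (F : I -> T -> C) : fn_open S U ->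
  (forall i, fn_regular S U (F i)) -> fn_regular S U (fun x => \prod_(i <- r | P i) F i x).
Proof.
move=> oU H; elim: r => [|i r IH].
  by under [X in fn_regular _ _ X]eq_fun do rewrite big_nil; apply: fs_cst.
under [X in fn_regular _ _ X]eq_fun do rewrite big_cons.
by case: (P i) => //; apply: fs_mul.
Qed.

Lemma fs_exp U f n : fn_open S U -> fn_regular S U f -> fn_regular S U (fun x => f x ^+ n).
Proof.
move=> oU rf; elim: n => [|n IH].
  by under [X in fn_regular _ _ X]eq_fun do rewrite expr0; apply: fs_cst.
by under [X in fn_regular _ _ X]eq_fun do rewrite exprS; apply: fs_mul.
Qed.

Lemma fs_meval U N (p : {mpoly C[N]}) (e : 'I_N -> T -> C) : fn_open S U ->
  (forall i, fn_regular S U (e i)) -> fn_regular S U (fun x => p.@[e^~ x]).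
Proof.
move=> oU H; under [X in fn_regular _ _ X]eq_fun do rewrite mevalE.
apply: fs_sum => // m; apply: fs_mul => //; first exact: fs_cst.
by apply: fs_prod => // i; apply: fs_exp.
Qed.

Definition nearby x (P : T -> Prop) := exists U, [/\ fn_open S U, U x & U `<=` P].

Lemma nearby_and x P Q : nearby x P -> nearby x Q -> nearby x (fun y => P y /\ Q y).
Proof.
move=> [U [oU Ux UP]] [V [oV Vx VQ]]; exists (U `&` V); split=> //; first exact: fs_openI.
by move=> y [/UP ? /VQ].
Qed.
Lemma nearby_sub x (P Q : T -> Prop) : (forall y, P y -> Q y) -> nearby x P -> nearby x Q.
Proof. by move=> PQ [U [oU Ux UP]]; exists U; split=> // y /UP /PQ. Qed.
Lemma nearby_all x (I : finType) (P : I -> T -> Prop) :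
  (forall i, nearby x (P i)) -> nearby x (fun y => forall i, P i y).
Proof.
move=> H; suff : nearby x (fun y => forall i, i \in enum I -> P i y).
  by apply: nearby_sub => y Hy i; apply: Hy; rewrite mem_enum.
elim: (enum I) => [|i s IH]; first by exists setT; split=> //; apply: fs_openT.
apply: nearby_sub (nearby_and (H i) IH) => y [Pi Ps] j.
by rewrite inE => /orP[/eqP ->|/Ps].
Qed.
Lemma nearby_open x U : fn_open S U -> U x -> nearby x U.
Proof. by exists U; split. Qed.
Section AtPoint.
Variable x : T.
Local Notation reg := (regular_at S x).

Lemma reg_cst a : reg (fun=> a).
Proof. by exists setT; split=> //; [apply: fs_openT|apply/fs_cst/fs_openT]. Qed.
Lemma reg_add f g : reg f -> reg g -> reg (fun y => f y + g y).
Proof.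
move=> [U [oU Ux rf]] [V [oV Vx rg]]; have oUV := fs_openI FS oU oV.
by exists (U `&` V); split=> //; apply: fs_add => //; [move: rf|move: rg];
  apply: fs_sub => // y [].
Qed.
Lemma reg_mul f g : reg f -> reg g -> reg (fun y => f y * g y).
Proof.
move=> [U [oU Ux rf]] [V [oV Vx rg]]; have oUV := fs_openI FS oU oV.
by exists (U `&` V); split=> //; apply: fs_mul => //; [move: rf|move: rg];
  apply: fs_sub => // y [].
Qed.
Lemma reg_opp f : reg f -> reg (fun y => - f y).
Proof.
move=> rf; under [X in regular_at _ _ X]eq_fun do rewrite -mulN1r.
by apply: reg_mul => //; apply: reg_cst.
Qed.
Lemma reg_sub f g : reg f -> reg g -> reg (fun y => f y - g y).
Proof. by move=> rf rg; apply: reg_add => //; apply: reg_opp. Qed.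
Lemma reg_inv f : reg f -> f x != 0 -> reg (fun y => (f y)^-1).
Proof.
move=> [U [oU Ux rf]] fx; have [oV rV] := fs_inv FS oU rf.
by exists [set y | U y /\ f y != 0].
Qed.
Lemma reg_neq0 f : reg f -> f x != 0 -> nearby x (fun y => f y != 0).
Proof.
move=> [U [oU Ux rf]] fx; have [oV rV] := fs_inv FS oU rf.
by exists [set y | U y /\ f y != 0]; split=> // y [].
Qed.
Lemma reg_sum (I : Type) (r : seq I) (P : pred I) (F : I -> T -> C) :
  (forall i, reg (F i)) -> reg (fun y => \sum_(i <- r | P i) F i y).
Proof.
move=> H; elim: r => [|i r IH].
  by under [X in regular_at _ _ X]eq_fun do rewrite big_nil; apply: reg_cst.
under [X in regular_at _ _ X]eq_fun do rewrite big_cons.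
by case: (P i) => //; apply: reg_add.
Qed.
Lemma reg_prod (I : Type) (r : seq I) (P : pred I) (F : I -> T -> C) :
  (forall i, reg (F i)) -> reg (fun y => \prod_(i <- r | P i) F i y).
Proof.
move=> H; elim: r => [|i r IH].
  by under [X in regular_at _ _ X]eq_fun do rewrite big_nil; apply: reg_cst.
under [X in regular_at _ _ X]eq_fun do rewrite big_cons.
by case: (P i) => //; apply: reg_mul.
Qed.
Lemma reg_det n (A : 'I_n -> 'I_n -> T -> C) : (forall i j, reg (A i j)) ->
  reg (fun y => \det (\matrix_(i, j) A i j y)).
Proof.
move=> H; rewrite /determinant; apply: reg_sum => s; apply: reg_mul; first exact: reg_cst.
under [X in regular_at _ _ X]eq_fun do under eq_bigr do rewrite mxE.
exact: reg_prod.
Qed.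

(* The square of the maximal ideal of the local ring at x. *)
Inductive in_m2 : (T -> C) -> Prop :=
| m2_zero : in_m2 (fun=> 0)
| m2_mul a b : reg a -> reg b -> a x = 0 -> b x = 0 -> in_m2 (fun y => a y * b y)
| m2_add f g : in_m2 f -> in_m2 g -> in_m2 (fun y => f y + g y)
| m2_local f g : nearby x (fun y => f y = g y) -> in_m2 f -> in_m2 g.

Lemma m2_regM h f : reg h -> in_m2 f -> in_m2 (fun y => h y * f y).
Proof.
move=> rh; elim=> [|a b ra rb ax bx|{}f g _ IHf _ IHg|{}f g E _ IH].
- by under [X in in_m2 X]eq_fun do rewrite mulr0; apply: m2_zero.
- under [X in in_m2 X]eq_fun do rewrite mulrA; apply: m2_mul => //; first exact: reg_mul.
  by rewrite ax mulr0.
- by under [X in in_m2 X]eq_fun do rewrite mulrDr; apply: m2_add.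
- by apply: m2_local IH; apply: nearby_sub E => y ->.
Qed.
Lemma m2_opp f : in_m2 f -> in_m2 (fun y => - f y).
Proof.
move=> H; under [X in in_m2 X]eq_fun do rewrite -mulN1r.
by apply: m2_regM => //; apply: reg_cst.
Qed.
Lemma m2_sub f g : in_m2 f -> in_m2 g -> in_m2 (fun y => f y - g y).
Proof. by move=> Hf Hg; apply: m2_add => //; apply: m2_opp. Qed.
Lemma m2_sum (I : Type) (r : seq I) (P : pred I) (F : I -> T -> C) :
  (forall i, in_m2 (F i)) -> in_m2 (fun y => \sum_(i <- r | P i) F i y).
Proof.
move=> H; elim: r => [|i r IH].
  by under [X in in_m2 X]eq_fun do rewrite big_nil; apply: m2_zero.
under [X in in_m2 X]eq_fun do rewrite big_cons.
by case: (P i) => //; apply: m2_add.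
Qed.

Variables (N : nat) (c : 'I_N -> T -> C) (V : set T).
Hypotheses (CV : chart S c V) (Vx : V x).

Lemma chart_reg i : reg (c i).
Proof. by exists V; split=> //; [apply: chart_open CV|apply: chart_coord CV _]. Qed.

(** A first-order expansion with regular coefficients: the functions having one contain the
    constants and coordinates and are stable under sum and product. *)
Lemma meval_lin (p : {mpoly C[N]}) : exists r : 'I_N -> T -> C,
  (forall i, reg (r i)) /\
  forall y, p.@[c^~ y] - p.@[c^~ x] = \sum_i r i y * (c i y - c i x).
Proof.
pose lin f := reg f /\ exists r : 'I_N -> T -> C, (forall i, reg (r i)) /\
  forall y, f y - f x = \sum_i r i y * (c i y - c i x).
suff [] : lin (fun y => p.@[c^~ y]) by [].
have lin_cst a : lin (fun=> a).
  split; first exact: reg_cst.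
  exists (fun _ _ => 0); split=> [i|y]; first exact: reg_cst.
  by rewrite subrr big1 // => i _; rewrite mul0r.
have lin_add f g : lin f -> lin g -> lin (fun y => f y + g y).
  move=> [rf [r [rr Hr]]] [rg [s [rs Hs]]]; split; first exact: reg_add.
  exists (fun i y => r i y + s i y); split=> [i|y]; first exact: reg_add.
  by rewrite opprD addrACA Hr Hs -big_split; apply: eq_bigr => i _; rewrite mulrDl.
have lin_mul f g : lin f -> lin g -> lin (fun y => f y * g y).
  move=> [rf [r [rr Hr]]] [rg [s [rs Hs]]]; split; first exact: reg_mul.
  exists (fun i y => g y * r i y + f x * s i y); split=> [i|y].
    by apply: reg_add; apply: reg_mul => //; apply: reg_cst.
  transitivity (g y * (f y - f x) + f x * (g y - g x)).
    by rewrite !mulrBr [g y * f y]mulrC [g y * f x]mulrC addrA subrK.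
  rewrite Hr Hs !mulr_sumr -big_split; apply: eq_bigr => i _.
  by rewrite mulrDl !mulrA.
have lin_c i : lin (c i).
  split; first exact: chart_reg.
  exists (fun j _ => (i == j)%:R); split=> [j|y]; first exact: reg_cst.
  rewrite (bigD1 i) //= eqxx mul1r big1 ?addr0 // => j /negbTE.
  by rewrite eq_sym => ->; rewrite mul0r.
have lin_exp f n : lin f -> lin (fun y => f y ^+ n).
  move=> H; elim: n => [|n IH].
    by under [X in lin X]eq_fun do rewrite expr0; apply: (lin_cst).
  by under [X in lin X]eq_fun do rewrite exprS; apply: (lin_mul).
under [X in lin X]eq_fun do rewrite mevalE.
elim: (msupp p) => [|m s IH].
  by under [X in lin X]eq_fun do rewrite big_nil; apply: (lin_cst).
under [X in lin X]eq_fun do rewrite big_cons.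
apply: (lin_add) => //; apply: (lin_mul) => //.
elim: (index_enum _) => [|i t IHt].
  by under [X in lin X]eq_fun do rewrite big_nil; apply: (lin_cst).
under [X in lin X]eq_fun do rewrite big_cons.
by apply: (lin_mul) => //; apply: (lin_exp).
Qed.

Lemma maximal_ideal_gen f : reg f -> f x = 0 -> exists r : 'I_N -> T -> C,
  (forall i, reg (r i)) /\ nearby x (fun y => f y = \sum_i r i y * (c i y - c i x)).
Proof.
move=> rf fx; have [p [q [W [oW Wx Hpq]]]] := chart_regular CV rf Vx.
have [r [rr Hr]] := meval_lin p.
have [qx px] := Hpq _ Wx.
have p0 : p.@[c^~ x] = 0.
  by move/eqP: px; rewrite fx eq_sym mulf_eq0 invr_eq0 (negbTE qx) orbF => /eqP.
exists (fun i y => r i y / q.@[c^~ y]); split=> [i|].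
  apply: reg_mul => //; apply: reg_inv => //; exists V; split=> //; first exact: chart_open CV.
  by apply: fs_meval; [apply: chart_open CV|apply: chart_coord CV].
apply: nearby_sub (nearby_open oW Wx) => y /Hpq [qy ->].
have := Hr y; rewrite p0 subr0 => ->; rewrite mulr_suml.
by apply: eq_bigr => i _; rewrite mulrAC.
Qed.

Lemma m2_gen f : in_m2 f -> exists r : 'I_N -> T -> C,
  [/\ forall i, reg (r i), forall i, r i x = 0 &
      nearby x (fun y => f y = \sum_i r i y * (c i y - c i x))].
Proof.
elim=> [|a b ra rb ax bx|{}f g _ [r [rr r0 Hr]] _ [s [rs s0 Hs]]|{}f g E _ [r [rr r0 Hr]]].
- exists (fun _ _ => 0); split=> //; first by move=> i; apply: reg_cst.
  apply: nearby_sub (nearby_open (fs_openT FS) Logic.I) => y _.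
  by rewrite big1 // => i _; rewrite mul0r.
- have [r [rr Hr]] := maximal_ideal_gen rb bx.
  exists (fun i y => a y * r i y); split=> [i|i|]; first exact: reg_mul.
    by rewrite ax mul0r.
  apply: nearby_sub Hr => y ->; rewrite mulr_sumr; apply: eq_bigr => i _; by rewrite mulrA.
- exists (fun i y => r i y + s i y); split=> [i|i|]; first exact: reg_add.
    by rewrite r0 s0 addr0.
  apply: nearby_sub (nearby_and Hr Hs) => y [-> ->].
  by rewrite -big_split; apply: eq_bigr => i _; rewrite mulrDl.
- by exists r; split=> //; apply: nearby_sub (nearby_and E Hr) => y [<-].
Qed.
End AtPoint.
End Calculus.

Section Morphisms.
Variables (T T1 T2 : Type) (S : fstruct R T) (S1 : fstruct R T1) (S2 : fstruct R T2).

Lemma morphism_comp (f : T -> T1) (g : T1 -> T2) :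
  morphism S S1 f -> morphism S1 S2 g -> morphism S S2 (g \o f).
Proof.
move=> mf mg U /mg [oU rU]; have [oV rV] := mf _ oU; split=> // h /rU; exact: rV.
Qed.
Lemma morphism_id : morphism S S id.
Proof. by []. Qed.
Lemma morphism_cst (a : T1) : function_space S -> morphism S S1 (fun=> a).
Proof.
move=> FS U oU; have oV : fn_open S ((fun=> a) @^-1` U).
  by apply: (fs_open_local FS) => x Ux; exists setT; split=> //; apply: fs_openT.
by split=> // h _; apply: fs_cst.
Qed.
Lemma morphism_pair (f : T -> T1) (g : T -> T2) : function_space S ->
  morphism S S1 f -> morphism S S2 g -> morphism S (prod_struct S1 S2) (fun x => (f x, g x)).
Proof.
move=> FS mf mg.
have rt V W h : fn_open S1 V -> fn_open S2 W -> tensor S1 S2 V W h ->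
    fn_open S (f @^-1` V `&` g @^-1` W) /\
    fn_regular S (f @^-1` V `&` g @^-1` W) (fun x => h (f x, g x)).
  move=> oV oW [m [u [v [ru rv ->]]]].
  have [oV' rV] := mf _ oV; have [oW' rW] := mg _ oW.
  have oVW := fs_openI FS oV' oW'; split=> //=; apply: fs_sum => // i; apply: fs_mul => //.
    by apply: fs_sub (rV _ (ru i)) => // y [].
  by apply: fs_sub (rW _ (rv i)) => // y [].
move=> U oU; have oU' : fn_open S ((fun x => (f x, g x)) @^-1` U).
  apply: (fs_open_local FS) => x Ux; have [V [W [h [oV oW [Vx Wx] th [hx Hh]]]]] := oU _ Ux.
  have [oVW rh] := rt _ _ _ oV oW th; have [oh _] := fs_inv FS oVW rh.
  by eexists; split; [exact: oh|split|move=> y [[Vy Wy] hy]; apply: Hh].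
split=> // F rF; apply: (fs_local FS) => // x Ux.
have [V [W [h [k [[oV oW] [Vx Wx] [th tk] kx Hk]]]]] := rF _ Ux.
have [oVW rh] := rt _ _ _ oV oW th; have [_ rk] := rt _ _ _ oV oW tk.
have [ok rki] := fs_inv FS oVW rk.
exists [set y | (f @^-1` V `&` g @^-1` W) y /\ k (f y, g y) != 0].
exists (fun y => h (f y, g y) / k (f y, g y)); split=> //.
  apply: fs_mul => //; apply: fs_sub rh => // y; by case.
by move=> y Uy [[Vy Wy] ky] /=; apply: Hk.
Qed.
Lemma morphism_regular_at (f : T -> T1) x h : morphism S S1 f -> regular_at S1 (f x) h ->
  regular_at S x (h \o f).
Proof.
move=> mf [U [oU Ux rh]]; have [oV rV] := mf _ oU.
by exists (f @^-1` U); split=> //; apply: rV.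
Qed.
Lemma morphism_nearby (f : T -> T1) x P : morphism S S1 f -> nearby S1 (f x) P ->
  nearby S x (P \o f).
Proof.
by move=> mf [U [oU Ux UP]]; have [oV _] := mf _ oU; exists (f @^-1` U); split=> // y /UP.
Qed.
End Morphisms.

Lemma morphism_factor (T : Type) (T1 : choiceType) (S : fstruct R T) (S1 : fstruct R T1)
    (Z : set T1) (f : T -> Z) : function_space S ->
  morphism S S1 (val \o f) -> morphism S (sub_struct S1 Z) f.
Proof.
move=> FS mf U [V oV EU]; have oU : fn_open S (f @^-1` U).
  by rewrite EU; have [] := mf _ oV.
split=> // h rh; apply: (fs_local FS) => // x Ux.
have [W [k [oW Wx rk Hk]]] := rh _ Ux; have [oW' rW] := mf _ oW.
exists ((val \o f) @^-1` W), (k \o (val \o f)); split=> //; first exact: rW.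
by move=> y Uy Wy; apply: Hk.
Qed.

(** * The noetherian topology of projective varieties *)

Section Noetherian.
Variables (T : Type) (S : fstruct R T) (n : nat) (iota : T -> pspace R n).
Hypothesis E : embedded S iota.

(** If each inclusion were strict, some z k in Z k outside Z k.+1 would be separated by a polynomial
    p k vanishing on Z k.+1. Some p m lies in the ideal of its predecessors, all of which vanish at
    z m. *)
Lemma closed_descending (Z : nat -> set T) : (forall k, fn_closed S (Z k)) ->
  (forall k l, (k <= l)%N -> Z l `<=` Z k) -> exists k, Z k `<=` Z k.+1.
Proof.
move=> cZ dZ; apply: contrapT => H.
have {}H k : exists z, Z k z /\ ~ Z k.+1 z.
  apply: contrapT => no; apply: H; exists k => z Zz; apply: contrapT => nz.
  by apply: no; exists z.
have [z Hz] := choice H.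
have Hp k : exists p : {mpoly C[n.+1]}, peval p (iota (z k)) != 0 /\
    forall y, Z k.+1 y -> peval p (iota y) = 0.
  have [p [_ pz Hp]] := (emb_open E _).1 (cZ k.+1) _ (Hz k).2.
  exists p; split=> // y Zy; apply/eqP/negPn/negP => /Hp; exact.
have [p pP] := choice Hp.
have [m Hm] := noetherian_seq p (@noetherian_mpoly _ n.+1 (@noetherian_field C)).
suff : peval (p m) (iota (z m)) = 0 by apply/eqP; exact: (pP m).1.
elim: Hm => [|a b x [i im ->] _ IH]; first by rewrite /peval rmorph0.
rewrite pevalD pevalM IH addr0 (pP i).2 ?mulr0 //.
exact: dZ im _ (Hz m).1.
Qed.

Lemma closed_point x : fn_closed S [set x].
Proof.
apply/(emb_open E) => y /= yx.
(* A nonzero 2 x 2 minor of the coordinates of x and y is, as a function of y, a linear form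
   vanishing at x; if all minors vanish, the two vectors are proportional. *)
have [|H] := pselect (exists i j, val (iota x) 0 i * val (iota y) 0 j !=
                          val (iota x) 0 j * val (iota y) 0 i).
  move=> [i [j Hij]].
  pose p : {mpoly C[n.+1]} := val (iota x) 0 i *: 'X_j - val (iota x) 0 j *: 'X_i.
  have pE z : peval p (iota z) = val (iota x) 0 i * val (iota z) 0 j -
     val (iota x) 0 j * val (iota z) 0 i by rewrite /peval rmorphB /= !mevalZ !mevalXU.
  exists p; split; last first.
  - by move=> z; rewrite pE => H ezx; move: H; rewrite ezx mulrC subrr eqxx.
  - by rewrite pE subr_eq0.
  by exists 1%N; apply: rpredB; apply: dhomogZ; rewrite dhomogX /= mdeg1.
have {}H i j : val (iota x) 0 i * val (iota y) 0 j = val (iota x) 0 j * val (iota y) 0 i.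
  by apply/eqP/negPn/negP => Hij; apply: H; exists i, j.
have [i xi] := pspace_neq0 (iota x); have [j yj] := pspace_neq0 (iota y).
case: yx; apply: (emb_inj E); 
apply: (@pspace_scale_inj _ _ _ _ (val (iota y) 0 i / val (iota x) 0 i)).
  rewrite mulf_neq0 ?invr_eq0 //; apply/eqP => yi.
  by have := H i j; rewrite yi mulr0 => /eqP; rewrite mulf_eq0 (negbTE xi) (negbTE yj).
by apply/rowP => k; rewrite mxE mulrAC [X in X / _]mulrC -H mulrAC divff // mul1r.
Qed.
End Noetherian.
End FunctionSpaces.

(** * Torsion of abelian varieties *)

Section AbelianVarieties.
Variable R : realType.
Local Notation C := R[i].

Lemma abelian_fs (A : gspace R) : abelian_variety A -> function_space (gs_fn A).
Proof.
by case=> pA _ _ _; have [n [iota E]] := projective_embedded pA; apply: embedded_function_space E.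
Qed.

Section IntoGroup.
Variables (A : gspace R) (AA : abelian_variety A).
Variables (T : Type) (S : fstruct R T) (FS : function_space S).

Lemma morphism_add (f g : T -> A) : morphism S (gs_fn A) f -> morphism S (gs_fn A) g ->
  morphism S (gs_fn A) (fun x => f x + g x).
Proof.
case: AA => _ _ mD _ mf mg.
exact: (morphism_comp (morphism_pair FS mf mg) mD).
Qed.
Lemma morphism_opp (f : T -> A) : morphism S (gs_fn A) f -> morphism S (gs_fn A) (fun x => - f x).
Proof. by case: AA => _ _ _ mN mf; apply: (morphism_comp mf mN). Qed.
Lemma morphism_sub (f g : T -> A) : morphism S (gs_fn A) f -> morphism S (gs_fn A) g ->
  morphism S (gs_fn A) (fun x => f x - g x).
Proof. by move=> mf mg; apply: morphism_add => //; apply: morphism_opp. Qed.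
Lemma morphism_muln (f : T -> A) n : morphism S (gs_fn A) f ->
  morphism S (gs_fn A) (fun x => f x *+ n).
Proof.
move=> mf; elim: n => [|n IH].
  under [X in morphism _ _ X]eq_fun do rewrite mulr0n.
  exact: morphism_cst.
under [X in morphism _ _ X]eq_fun do rewrite mulrS.
exact: morphism_add.
Qed.
Lemma morphism_sum (I : Type) (r : seq I) (P : pred I) (F : I -> T -> A) :
  (forall i, morphism S (gs_fn A) (F i)) ->
  morphism S (gs_fn A) (fun x => \sum_(i <- r | P i) F i x).
Proof.
move=> H; elim: r => [|i r IH].
  under [X in morphism _ _ X]eq_fun do rewrite big_nil.
  exact: morphism_cst.
under [X in morphism _ _ X]eq_fun do rewrite big_cons.
by case: (P i) => //; apply: morphism_add.
Qed.
End IntoGroup.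

Section OneVariety.
Variables (A : gspace R) (AA : abelian_variety A).
Let S := gs_fn A.
Let FS : function_space S := abelian_fs AA.
Let m_id : morphism S S id := @morphism_id R _ S.
Let m_cst a : morphism S S (fun=> a) := morphism_cst a FS.
Local Notation m2 := (in_m2 S 0).
Local Notation reg := (regular_at S 0).

(** For h a sum of products u(x) v(y), the mixed second difference at 0 is the sum of (u(x) - u(0))
    (v(y) - v(0)), a product of two functions vanishing at 0. *)
Lemma tensor_m2 (psi : A -> A) V W (h : A * A -> C) : morphism S S psi -> psi 0 = 0 ->
  fn_open S V -> fn_open S W -> V 0 -> W 0 -> tensor S S V W h ->
  [/\ reg (fun x => h (x, psi x)), reg (fun x => h (x, 0)), reg (fun x => h (0, psi x)) &
  m2 (fun x => h (x, psi x) - (h (x, 0) + h (0, psi x) - h (0, 0)))].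
Proof.
move=> mpsi psi0 oV oW V0 W0 [m [u [v [ru rv ->]]]] /=.
have ru' i : reg (u i) by exists V.
have rv' i : reg (fun x => v i (psi x)).
  by apply: (morphism_regular_at mpsi); rewrite psi0; exists W.
have rc a : reg (fun=> a) := reg_cst FS 0 a.
split; try by apply: (reg_sum FS) => i; apply: (reg_mul FS).
rewrite [X in in_m2 _ _ X](_ : _ = fun x => \sum_i (u i x - u i 0) * (v i (psi x) - v i 0)); last first.
  by apply/funext => x; rewrite -big_split /= -!sumrB; apply: eq_bigr => i _; ring.
apply: m2_sum => i; apply: m2_mul; try exact: (reg_sub FS).
  by rewrite subrr.
by rewrite psi0 subrr.
Qed.

(* A regular function F on A x A satisfies F(x, y) = F(x, 0) + F(0, y) - F(0, 0)
   modulo m_x m_y; this is applied to F = f(x + y) on the graph of psi. *)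
Lemma regular_add_m2 (psi : A -> A) f : morphism S S psi -> psi 0 = 0 -> reg f -> f 0 = 0 ->
  m2 (fun x => f (x + psi x) - (f x + f (psi x))).
Proof.
move=> mpsi psi0 rf f0.
have [_ _ mD _] := AA; have [U [oU U0 rU]] := rf.
have [oP rP] := mD U oU.
have [|V [W [h [k [[oV oW] [/= V0 W0] [th tk] k0 Hhk]]]]] := rP f rU (0, 0).
  by rewrite /= addr0.
have [rh rh1 rh2 mh] := tensor_m2 mpsi psi0 oV oW V0 W0 th.
have [rk rk1 rk2 mk] := tensor_m2 mpsi psi0 oV oW V0 W0 tk.
set hh := fun x => h (x, psi x) in rh mh; set h1 := fun x => h (x, 0) in rh1 mh.
set h2 := fun x => h (0, psi x) in rh2 mh; set h0 := h (0, 0) in mh.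
set kk := fun x => k (x, psi x) in rk mk; set k1 := fun x => k (x, 0) in rk1 mk.
set k2 := fun x => k (0, psi x) in rk2 mk; set kc := k (0, 0) in mk k0.
have h00 : h0 = 0.
  have := Hhk (0, 0); rewrite /= addr0 => /(_ U0 V0 W0 k0); rewrite f0 => /eqP.
  by rewrite eq_sym mulf_eq0 invr_eq0 (negbTE k0) orbF => /eqP.
have nkk : nearby S 0 (fun x => kk x != 0) by apply: (reg_neq0 FS) => //; rewrite /kk psi0.
have nk1 : nearby S 0 (fun x => k1 x != 0) by apply: (reg_neq0 FS).
have nk2 : nearby S 0 (fun x => k2 x != 0) by apply: (reg_neq0 FS) => //; rewrite /k2 psi0.
have nV := nearby_open oV V0.
have npsi P : nearby S 0 P -> nearby S 0 (P \o psi).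
  by move=> H; apply: (morphism_nearby mpsi); rewrite psi0.
have nW := npsi _ (nearby_open oW W0).
have nU : nearby S 0 (fun x => U (x + psi x)).
  apply: (@morphism_nearby _ _ _ S S (fun x => x + psi x) 0 U); first exact: morphism_add.
  by rewrite psi0 addr0; apply: nearby_open.
have rcp : reg (f \o psi) by apply: (morphism_regular_at mpsi); rewrite psi0.
(* Write F(x, y) = f(x + y) as h / k. Multiplying the difference by k and using f k1 = h1 and (f o
   psi) k2 = h2 leaves the mixed differences of h and k and two products of functions vanishing at
   0. *)
pose E x := (kk x)^-1 * ((hh x - (h1 x + h2 x - h0)) -
   ((f x + f (psi x)) * (kk x - (k1 x + k2 x - kc))
     + (f x * (k2 x - kc) + f (psi x) * (k1 x - kc)))).
apply: (@m2_local _ _ _ _ E).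
  apply: nearby_sub (nearby_and FS (nearby_and FS (nearby_and FS nkk nk1) (nearby_and FS nk2 nV))
    (nearby_and FS (nearby_and FS nW nU)
      (nearby_and FS (nearby_open oU U0) (npsi _ (nearby_open oU U0))))).
  move=> x [[[kkx k1x] [k2x Vx]] [[Wx Ux] [U1x U2x]]].
  have e1 : f (x + psi x) = hh x / kk x by apply: (Hhk (x, psi x)).
  have e2 : f x * k1 x = h1 x.
    by have := Hhk (x, 0); rewrite /= addr0 => ->//; rewrite divfK.
  have e3 : f (psi x) * k2 x = h2 x.
    by have := Hhk (0, psi x); rewrite /= add0r => ->//; rewrite divfK.
  rewrite /E -e2 -e3 h00 e1; field; exact: kkx.
apply: (m2_regM FS); first by apply: (reg_inv FS) => //; rewrite /kk psi0.
apply: (m2_sub FS) => //; apply: m2_add.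
  by apply: (m2_regM FS) => //; apply: (reg_add FS).
have rc : reg (fun=> kc) := reg_cst FS 0 kc.
apply: m2_add; apply: m2_mul => //; try exact: (reg_sub FS).
- by rewrite /k2 psi0 subrr.
- by rewrite psi0.
- by rewrite /k1 subrr.
Qed.

Lemma regular_muln_m2 f n : reg f -> f 0 = 0 -> m2 (fun x => f (x *+ n) - f x *+ n).
Proof.
move=> rf f0; elim: n => [|n IH].
  under [X in in_m2 _ _ X]eq_fun do rewrite !mulr0n f0 subrr.
  exact: m2_zero.
under [X in in_m2 _ _ X]eq_fun => x.
  rewrite !mulrS (_ : _ - _ = f (x + x *+ n) - (f x + f (x *+ n)) + (f (x *+ n) - f x *+ n)); last first.
    by rewrite !opprD !addrA subrK.
  over.
apply: m2_add => //; apply: (@regular_add_m2 (fun x => x *+ n)) => //.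
  exact: morphism_muln.
by rewrite mul0rn.
Qed.

(* On A[n] each coordinate is -1/n times an element of m^2, i.e. the vector of
   coordinates is killed by a matrix that is invertible near 0. *)
Lemma torsion_isolated n : (0 < n)%N -> nearby S 0 (fun x => x *+ n = 0 -> x = 0).
Proof.
move=> n_gt0; have [pA _ _ _] := AA; have [d [iota E]] := projective_embedded pA.
have [N [c [V [CV V0]]]] := embedded_chart 0 E.
pose b i x := c i x - c i 0.
have rb i : reg (b i) by apply: (reg_sub FS) (reg_cst FS _ _); apply: (chart_reg CV).
have b0 i : b i 0 = 0 by rewrite /b subrr.
have H j : exists q : 'I_N -> A -> C, [/\ forall i, reg (q i), forall i, q i 0 = 0 &
    nearby S 0 (fun x => b j (x *+ n) - b j x *+ n = \sum_i q i x * b i x)].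
  exact: (m2_gen FS CV V0 (regular_muln_m2 n (rb j) (b0 j))).
have [q Hq] := choice H.
have nq : nearby S 0 (fun x => forall j, b j (x *+ n) - b j x *+ n = \sum_i q j i x * b i x).
  by apply: (nearby_all FS) => j; case: (Hq j).
pose M i j (x : A) := (i == j)%:R *+ n + q j i x.
have rM i j : reg (M i j).
  by apply: (reg_add FS); [apply: reg_cst|case: (Hq j)].
have rdet := reg_det FS rM.
have ndet : nearby S 0 (fun x => \det (\matrix_(i, j) M i j x) != 0).
  apply: (reg_neq0 FS) => //.
  rewrite (_ : \matrix_(i, j) M i j 0 = n%:R%:M); last first.
    apply/matrixP => i j; rewrite !mxE /M; case: (Hq j) => _ -> _.
    rewrite addr0; case: (i == j); last by rewrite mulr0n mul0rn.
    by rewrite !mulr1n.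
  by rewrite det_scalar expf_neq0 // pnatr_eq0 -lt0n.
apply: nearby_sub (nearby_and FS (nearby_and FS nq ndet) (nearby_open (chart_open CV) V0)).
move=> x [[Hx Dx] Vx] xn0.
have Mb : (\row_i b i x) *m \matrix_(i, j) M i j x = 0.
  apply/rowP => j; rewrite !mxE.
  under eq_bigr => i _ do rewrite !mxE /M mulrDr [b i x * q _ _ _]mulrC.
  rewrite big_split /= -Hx xn0 b0 sub0r (bigD1 j) //= eqxx big1 ?addr0 => [|i /negbTE ->].
    by rewrite mulr_natr subrr.
  by rewrite mul0rn mulr0.
have /rowP b_eq0 : \row_i b i x = 0.
  have uM : (\matrix_(i, j) M i j x) \in unitmx by rewrite unitmxE unitfE.
  by rewrite -(mulmxK uM (\row_i b i x)) Mb mul0mx.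
apply: (chart_inj CV) => // i; apply/eqP; rewrite -subr_eq0.
by have := b_eq0 i; rewrite !mxE /b => ->.
Qed.

Lemma nearby_translate a P : nearby S 0 P -> nearby S a (fun x => P (x - a)).
Proof.
move=> nP; apply: (@morphism_nearby _ _ _ S S (fun x => x - a)).
  exact: morphism_sub.
by rewrite subrr.
Qed.

Lemma closed_preim (T : Type) (S' : fstruct R T) (f : A -> T) Z : morphism S S' f ->
  fn_closed S' Z -> fn_closed S (f @^-1` Z).
Proof. by move=> mf cZ; have [] := mf _ cZ. Qed.

Lemma torsion_finite n : (0 < n)%N -> finite_set [set a : A | a *+ n = 0].
Proof.
move=> n_gt0; have [pA _ _ _] := AA; have [d [iota E]] := projective_embedded pA.
have iso := torsion_isolated n_gt0.
set K := [set a : A | a *+ n = 0].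
have cK : fn_closed S K.
  by apply: (@closed_preim _ S (fun x => x *+ n) [set 0]);
    [apply: morphism_muln|apply: closed_point E _].
(* Translating the isolated point 0 shows that K is discrete; being closed as well, it has only
   closed subsets. The tails of an injective sequence in K would then be a strictly descending chain
   of closed sets. *)
have subK Z : Z `<=` K -> fn_closed S Z.
  move=> ZK; apply: (fs_open_local FS) => x nZx.
  have [Kx|nKx] := pselect (K x); last by exists (~` K); split=> // y nKy /ZK.
  have [U [oU Ux HU]] := nearby_translate x iso.
  exists U; split=> // y /HU Hy Zy; apply: nZx.
  have -> // : x = y; apply/eqP; rewrite eq_sym -subr_eq0; apply/eqP/Hy.
  by rewrite mulrnBl (ZK _ Zy) Kx subrr.
apply: contrapT => /infiniteP/card_leP [f].
have [g [gK gI]] : exists g : nat -> A, (forall i, K (g i)) /\ injective g.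
  exists (fun i => val (f (SigSub (in_setT i)))); split=> [i|i j /val_inj]; first exact: set_valP.
  by move=> /(@inj _ _ _ f); rewrite !inE => /(_ Logic.I Logic.I) /(congr1 val).
have [|k l kl|k] := closed_descending E (Z := fun k => [set g i | i in [set i | (k <= i)%N]]).
- by move=> k; apply: subK => _ [i _ <-].
- by move=> _ [i /= li <-]; exists i => //=; apply: leq_trans li.
move=> /(_ (g k)) []; first by exists k => /=.
by move=> i /= ki /gI eik; move: ki; rewrite eik ltnn.
Qed.
End OneVariety.
End AbelianVarieties.

(** * Images of homomorphisms and divisibility *)

Section Images.
Variable R : realType.
Local Notation C := R[i].

(** * Images of morphisms contain an open part of their closure *)

Section Chevalley.
Variables (T T' : Type) (S : fstruct R T) (S' : fstruct R T').
Hypotheses (FS : function_space S) (FS' : function_space S').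
Variable (phi : T -> T').
Hypothesis mphi : morphism S S' phi.
Hypothesis irrT : irreducible_set S setT.
Variables (N M : nat) (c : 'I_N -> T -> C) (V : set T) (c' : 'I_M -> T' -> C) (V' : set T').
Variables (x0 : T).
Hypotheses (CV : chart S c V) (CV' : chart S' c' V') (Vx0 : V x0) (V'x0 : V' (phi x0)).

Definition adherent (B : set T') : set T' :=
  [set y | forall U, fn_open S' U -> U y -> exists2 z, B z & U z].

(* Elimination of the source coordinates from the ideal I of the graph of phi. *)
Lemma image_contains_open : exists O, [/\ fn_open S' O, exists x, O (phi x) &
  forall y, adherent (range phi) y -> O y -> range phi y].
Proof.
have Hpq i : exists pq : {mpoly C[N]} * {mpoly C[N]},
    nearby S x0 (fun y => pq.2.@[c^~ y] != 0 /\ c' i (phi y) = pq.1.@[c^~ y] / pq.2.@[c^~ y]).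
  have [|p [q [W [oW Wx H]]]] := chart_regular CV (f := c' i \o phi) (x := x0) _ Vx0.
    apply: (morphism_regular_at mphi); exists V'; split=> //; first exact: chart_open CV'.
    exact: chart_coord CV' _.
  by exists (p, q); exists W.
have {Hpq} [pq Hpq] := choice Hpq.
have nV' : nearby S x0 (V' \o phi).
  by apply: (morphism_nearby mphi); apply: nearby_open V'x0; apply: chart_open CV'.
have [O0 [oO0 O0x HO0]] := nearby_and FS (nearby_all FS Hpq) nV'.
have [v [vx Hv]] := chart_basis CV oO0 O0x Vx0.
(* On U0 the morphism lands in V' and its coordinates are fractions of polynomials in c; U0 is
   principal in V, so v != 0 suffices to recognize its points. *)
pose U0 := [set y | V y /\ v.@[c^~ y] != 0].
have oV := chart_open CV.
have oU0 : fn_open S U0.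
  by have [] := fs_inv FS oV (fs_meval FS v oV (chart_coord CV)).
have U0x : U0 x0 by [].
have U0O0 y : U0 y -> O0 y by case=> ? /Hv; apply.
have reg_c i : fn_regular S U0 (c i).
  by apply: (fs_sub FS oU0 _ oV); [move=> y []|apply: chart_coord CV _].
have reg_c' j : fn_regular S U0 (c' j \o phi).
  have [oW rW] := mphi (chart_open CV').
  apply: (fs_sub FS oU0 _ oW); first by move=> y /U0O0/HO0[].
  by apply: rW; apply: chart_coord CV' _.
pose ev y : {mpoly {mpoly C[M]}[N]} -> C :=
  mmap (meval (fun j => c' j (phi y))) (fun i => c i y).
pose I p := forall y, U0 y -> ev y p = 0.
have reg_ev p : fn_regular S U0 (fun y => ev y p).
  rewrite /ev /mmap; apply: (fs_sum FS) => // m; apply: (fs_mul FS) => //.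
    by apply: (@fs_meval _ _ _ FS U0 M _ (fun j => c' j \o phi)).
  by rewrite /mmap1; apply: (fs_prod FS) => // i; apply: (fs_exp FS).
have meet (P Q : set T) : fn_open S P -> fn_open S Q -> (exists x, P x) -> (exists x, Q x) ->
    exists x, P x /\ Q x.
  move=> oP oQ [x Px] [y Qy]; have [||z [_ [Pz Qz]]] := irrT.2 P Q oP oQ.
  - by exists x.
  - by exists y.
  by exists z.
have nI p : ~ I p -> exists y, U0 y /\ ev y p != 0.
  move=> Ip; apply: contrapT => no; apply: Ip => y Uy; apply/eqP/negPn/negP => ny.
  by apply: no; exists y.
have evD y p q : ev y (p + q) = ev y p + ev y q by rewrite /ev rmorphD.
have evB y p q : ev y (p - q) = ev y p - ev y q by rewrite /ev rmorphB.
have evM y p q : ev y (p * q) = ev y p * ev y q by rewrite /ev rmorphM.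
(* Primality is irreducibility of T: two nonempty open loci in U0 meet. *)
have PI : prime_ideal I.
  split.
  - by move=> y _; rewrite /ev rmorph0.
  - by move=> a b Ia Ib y Uy; rewrite evD Ia // Ib // addr0.
  - by move=> a b Ib y Uy; rewrite evM Ib // mulr0.
  - by move=> /(_ x0 U0x) /eqP; rewrite /ev rmorph1 oner_eq0.
  move=> a b Iab; have [|/nI [y Hy]] := pselect (I a); first by left.
  have [|/nI [z Hz]] := pselect (I b); first by right.
  have [oa _] := fs_inv FS oU0 (reg_ev a); have [ob _] := fs_inv FS oU0 (reg_ev b).
  have [|| w [[Uw aw] [_ bw]]] := meet _ _ oa ob; [by exists y|by exists z|].
  have /eqP := Iab w Uw; rewrite evM mulf_eq0.
  by rewrite (negbTE aw) (negbTE bw).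
pose hat (p : {mpoly C[N]}) : {mpoly {mpoly C[M]}[N]} := map_mpoly (@mpolyC M C) p.
have ev_hat y p : ev y (hat p) = p.@[c^~ y].
  have : ev y \o hat =1 meval (c^~ y).
    apply: mpoly_morph_ext => [a|i] /=.
      by rewrite /hat map_mpolyC /= /ev mmapC /= !mevalC.
    by rewrite /hat map_mpolyX /ev mmapX mmap1U mevalXU.
  exact.
have evC y (p : {mpoly C[M]}) : ev y p%:MP = p.@[c'^~ (phi y)] by rewrite /ev mmapC.
clearbody ev.
have Iv : ~ I (hat v) by move=> /(_ _ U0x); rewrite ev_hat => /eqP; rewrite (negbTE vx).
have [u Iu Hu] := extends_points_mpolyC C PI Iv.
have oV' := chart_open CV'.
have open_p (p : {mpoly C[M]}) : fn_open S' [set y | V' y /\ p.@[c'^~ y] != 0].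
  by have [] := fs_inv FS' oV' (fs_meval FS' p oV' (chart_coord CV')).
exists [set y | V' y /\ u.@[c'^~ y] != 0]; split; first exact: open_p.
  have [y [Uy]] := nI _ Iu; rewrite evC => uy; exists y; split=> //.
  by have [] := HO0 _ (U0O0 _ Uy).
move=> y By [V'y uy].
(* A polynomial of I in the target coordinates alone vanishes on phi(U0). Were it nonzero at y, it
   would be nonzero at some point of the image, hence, T being irreducible, at a point of
   phi(U0). *)
have [|chi [chiI chiv chiE]] := Hu (meval (c'^~ y)) _ uy.
  move=> p Ip; apply/eqP/negPn/negP => py.
  have [//|_ [a _ <-] pa] := By _ (open_p p).
  have [oP _] := mphi (open_p p).
  have [||b [[V'b pb] Ub]] := meet _ _ oP oU0; [by exists a|by exists x0|].
  by move: pb; rewrite -evC Ip // eqxx.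
pose a i := chi 'X_i.
have chi_hat p : chi (hat p) = p.@[a].
  have : chi \o (map_mpoly (@mpolyC M C) : {rmorphism {mpoly C[N]} -> {mpoly {mpoly C[M]}[N]}}) =1
      (meval a).
    apply: mpoly_morph_ext => [z|i] /=.
      by rewrite map_mpolyC /= chiE /= !mevalC.
    by rewrite map_mpolyX mevalXU.
  exact.
clearbody hat.
have [x [Vx ax]] : exists x, V x /\ forall i, a i = c i x.
  apply: (chart_closed CV) => p Hp; rewrite -chi_hat; apply: chiI => z [Vz _].
  by rewrite ev_hat Hp.
have aE (p : {mpoly C[N]}) : p.@[a] = p.@[c^~ x] by apply: meval_eq.
have U0x' : U0 x by split=> //; rewrite -aE -chi_hat.
exists x => //; have [Hx V'x] := HO0 _ (U0O0 _ U0x').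
(* The graph equation p_j - X_j q_j, with X_j the target coordinate, lies in I and so holds at the
   extended point. *)
apply: (chart_inj CV') => // j; have [qx ->] := Hx j.
apply: (mulIf qx); rewrite divfK // -!aE -!chi_hat.
have -> : c' j y = chi ('X_j)%:MP by rewrite chiE /= mevalXU.
apply/eqP; rewrite -subr_eq0 -rmorphM -rmorphB; apply/eqP/chiI => z Uz.
rewrite evB evM evC mevalXU !ev_hat.
have [/(_ j)[qz ->] _] := HO0 _ (U0O0 _ Uz).
by rewrite divfK // subrr.
Qed.
End Chevalley.

(** For y in the closure, y - O is an open set containing the adherent point y - phi x0, so it meets
    the image: some y - phi a lies in O. It is again adherent, hence in the image, and so is y. *)
Lemma image_closed (A A' : gspace R) (phi : {additive A -> A'}) : abelian_variety A ->
  abelian_variety A' -> morphism (gs_fn A) (gs_fn A') phi ->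
  fn_closed (gs_fn A') (range phi).
Proof.
move=> AA AA' mphi.
have FS := abelian_fs AA; have FS' := abelian_fs AA'.
have [pA irrA _ _] := AA; have [pA' _ _ _] := AA'.
have [n [iota E]] := projective_embedded pA; have [n' [iota' E']] := projective_embedded pA'.
have [N [c [V [CV V0]]]] := embedded_chart 0 E.
have [M [c' [V' [CV' V'0]]]] := embedded_chart (phi 0) E'.
have [O [oO [x0 Ox0] HO]] := image_contains_open FS FS' mphi irrA CV CV' V0 V'0.
have m_id : morphism (gs_fn A') (gs_fn A') id := @morphism_id R _ (gs_fn A').
have m_cst (a : A') : morphism (gs_fn A') (gs_fn A') (fun=> a) := morphism_cst a FS'.
pose B := adherent (gs_fn A') (range phi).
have Bsub a y : B y -> B (y - phi a).
  move=> By U oU Uy.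
  have [oU' _] : _ /\ _ := morphism_sub AA' FS' m_id (m_cst (phi a)) oU.
  have [_ [b _ <-] Ub] := By _ oU' Uy.
  by exists (phi b - phi a) => //; exists (b - a) => //; rewrite raddfB.
have Brange y : B y -> range phi y.
  move=> By.
  have [oO' _] : _ /\ _ := morphism_sub AA' FS' (m_cst y) m_id oO.
  have [|_ [a _ <-] Oa] := Bsub x0 y By _ oO'; first by rewrite /= opprB addrC subrK.
  have [b _ Eb] := HO _ (Bsub a _ By) Oa.
  by exists (b + a) => //; rewrite raddfD Eb subrK.
apply: (fs_open_local FS') => y ny.
have [U [oU Uy HU]] : exists U, [/\ fn_open (gs_fn A') U, U y & forall a, ~ U (phi a)].
  apply: contrapT => no; apply: ny; apply: Brange => U oU Uy.
  apply: contrapT => no'; apply: no; exists U; split=> // a Ua.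
  by apply: no'; exists (phi a) => //; exists a.
by exists U; split=> // z Uz [a _ Ea]; apply: (HU a); rewrite Ea.
Qed.

Lemma irreducible_cover T (S : fstruct R T) (FS : function_space S) (I : eqType)
    (s : seq I) (Z : I -> set T) :
  irreducible_set S setT -> (forall i, fn_closed S (Z i)) ->
  (forall x, exists2 i, i \in s & Z i x) -> exists2 i, i \in s & forall x, Z i x.
Proof.
(* Covering only a nonempty open W is enough, which makes the induction work: removing a proper
   closed Z i from W leaves a nonempty open set. *)
move=> [[x0 _] irr] cZ; suff H (t : seq I) (W : set T) : fn_open S W -> W !=set0 ->
    (forall x, W x -> exists2 i, i \in t & Z i x) -> exists2 i, i \in t & forall x, Z i x.
  by move=> Hs; apply: (H s setT) => //; [apply: fs_openT|exists x0].
elim: t W => [|i t IH] W oW [x Wx] HW; first by have [] := HW x Wx.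
have [Hi|nHi] := pselect (forall x, Z i x); first by exists i => //; rewrite mem_head.
have [y nZy] : exists y, ~ Z i y.
  by apply: contrapT => no; apply: nHi => y; apply: contrapT => ny; apply: no; exists y.
have [||z [_ [Wz nZz]]] := irr W (~` Z i) oW (cZ i); [by exists x|by exists y|].
have [|||j jt Hj] := IH (W `&` ~` Z i); first exact: (fs_openI FS oW (cZ i)).
- by exists z.
- move=> w [Ww nZw]; have [j] := HW w Ww; rewrite inE => /orP[/eqP ->//|jt Zj].
  by exists j.
by exists j => //; rewrite inE jt orbT.
Qed.

Lemma abelian_divisible (A : gspace R) n : abelian_variety A -> (0 < n)%N ->
  forall a : A, exists b, a = b *+ n.
Proof.
move=> AA n_gt0; have FS := abelian_fs AA.
have [pA irrA _ _] := AA; have [d [iota E]] := projective_embedded pA.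
have m_id : morphism (gs_fn A) (gs_fn A) id := @morphism_id R _ (gs_fn A).
have cZ m : fn_closed (gs_fn A) (range (fun a : A => a *+ m)).
  have add_m : additive (fun a : A => a *+ m) by move=> a b; rewrite mulrnBl.
  pose F := GRing.isAdditive.Build _ _ _ add_m.
  pose phi : {additive A -> A} := HB.pack (fun a : A => a *+ m) F.
  exact: (@image_closed A A phi AA AA (morphism_muln AA FS m m_id)).
have [|k l kl|k] := closed_descending E (Z := fun k => range (fun a : A => a *+ (n ^ k))).
- by move=> k; apply: cZ.
- by move=> _ [a _ <-]; exists (a *+ (n ^ (l - k))) => //; rewrite -mulrnA -expnD subnK.
move=> Hk; have /finite_seqP [s Es] : finite_set [set a : A | a *+ (n ^ k) = 0].
  by apply: torsion_finite => //; rewrite expn_gt0 n_gt0.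
have [||t ts Ht] := @irreducible_cover _ _ FS _ s 
  (fun t => [set a | range (fun b : A => b *+ n) (a - t)]) irrA.
- move=> t; apply: (@closed_preim _ A _ (gs_fn A) (fun a => a - t)) (cZ n).
  by apply: morphism_sub => //; apply: morphism_cst.
- move=> a; have [|b _ Eb] := Hk (a *+ (n ^ k)); first by exists a.
  exists (a - b *+ n); last by exists b => //; rewrite subKr.
  have : [set a : A | a *+ (n ^ k) = 0] (a - b *+ n) by rewrite /= mulrnBl -Eb -mulrnA -expnS subrr.
  by rewrite Es.
move=> a; have [b _ Eb] := Ht (a + t); exists b; by rewrite Eb addrK.
Qed.
End Images.

(** * Jacobians *)

Section Jacobians.
Variable R : realType.

Lemma curve_fs (X : curve R) : function_space (curve_fn X).
Proof.
have [n [iota E]] := projective_embedded (curve_projective X).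
exact: embedded_function_space E.
Qed.

Lemma curve_point (X : curve R) : exists x : X, True.
Proof. by have [[x _] _] := curve_irreducible X; exists x. Qed.

Section OneJacobian.
Variables (X : curve R) (J : jacobian X).
Local Notation cl := (jac_class J).

Definition pt_diff (x y : X) : {freeg X / int} := << 1 *g x >> - << 1 *g y >>.
Definition jac_pt (x y : X) : J := cl (pt_diff x y).

Lemma jac_abelian : abelian_variety J.
Proof. by have [H _ _ _ _] := jac_is_jacobian J. Qed.

Lemma deg_pt_diff x y : deg (pt_diff x y) = 0.
Proof. by rewrite /pt_diff raddfB /= !degU subrr. Qed.

Lemma clD D E : deg D = 0 -> deg E = 0 -> cl (D + E) = cl D + cl E.
Proof. by have [_ H _ _ _] := jac_is_jacobian J; apply: H. Qed.
Lemma cl0 : cl 0 = 0.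
Proof. by apply: (addIr (cl 0)); rewrite -clD ?deg0 // !add0r. Qed.
Lemma clN D : deg D = 0 -> cl (- D) = - cl D.
Proof.
move=> dD; apply: (addIr (cl D)); rewrite -clD ?addNr ?cl0 //.
by rewrite raddfN /= dD oppr0.
Qed.
Lemma clMz D (n : int) : deg D = 0 -> cl (D *~ n) = cl D *~ n.
Proof.
move=> dD; have nat_case k : cl (D *+ k) = cl D *+ k.
  elim: k => [|k IH]; first by rewrite !mulr0n cl0.
  by rewrite !mulrS clD ?IH // raddfMn /= dD mul0rn.
case: n => k; first exact: nat_case.
by rewrite !NegzE !mulrNz clN ?nat_case // -pmulrn raddfMn /= dD mul0rn.
Qed.
Lemma cl_sum (I : Type) (r : seq I) (F : I -> {freeg X / int}) :
  (forall i, deg (F i) = 0) -> cl (\sum_(i <- r) F i) = \sum_(i <- r) cl (F i).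
Proof.
move=> dF; elim: r => [|i r IH]; first by rewrite !big_nil cl0.
rewrite !big_cons clD ?IH // raddf_sum big1 // => j _; exact: dF.
Qed.

Lemma jac_pt_sub x y z : jac_pt x z - jac_pt y z = jac_pt x y.
Proof.
rewrite /jac_pt -clN ?deg_pt_diff // -clD ?raddfN /= ?deg_pt_diff ?oppr0 //.
by rewrite /pt_diff opprB addrA subrK.
Qed.
(** The class map is additive only in degree 0, so a base point is subtracted from each term, at
    total cost zero. A general [phi] covers pushforwards too, where points may collide. *)
Lemma cl_freeg_sum (I : Type) (s : seq I) (c : I -> int) (phi : I -> X) (x0 : X) :
  \sum_(i <- s) c i = 0 ->
  cl (\sum_(i <- s) << c i *g phi i >>) = \sum_(i <- s) jac_pt (phi i) x0 *~ c i.
Proof.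
move=> sc; have -> : \sum_(i <- s) << c i *g phi i >> = \sum_(i <- s) pt_diff (phi i) x0 *~ c i.
  under [RHS]eq_bigr do rewrite /pt_diff mulrzBl !freegU_mulz !intz.
  rewrite sumrB; suff -> : \sum_(i <- s) << c i *g x0 >> = 0 by rewrite subr0.
  apply/eqP/freeg_eqP => y; rewrite raddf_sum /= coeff0.
  under eq_bigr do rewrite coeffU.
  by rewrite -mulr_suml sc mul0r.
rewrite cl_sum => [|i]; last by rewrite raddfMz /= deg_pt_diff mul0rz.
by apply: eq_bigr => i _; rewrite clMz ?deg_pt_diff.
Qed.

Lemma deg_sum_coeff (D : {freeg X / int}) : deg D = \sum_(x <- dom D) coeff x D.
Proof.
by rewrite -{1}[D]freeg_sumE raddf_sum; apply: eq_bigr => x _; rewrite /= degU.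
Qed.

Lemma jac_span (x0 : X) (a : J) : exists D : {freeg X / int},
  [/\ deg D = 0, cl D = a & a = \sum_(x <- dom D) jac_pt x x0 *~ coeff x D].
Proof.
have [_ _ _ surj _] := jac_is_jacobian J; have [D dD Da] := surj a.
exists D; split=> //; rewrite -Da -{1}[D]freeg_sumE.
by apply: (cl_freeg_sum id); rewrite -deg_sum_coeff.
Qed.

Lemma jac_ext (V : zmodType) (f g : {additive J -> V}) :
  (forall x y, f (jac_pt x y) = g (jac_pt x y)) -> f =1 g.
Proof.
move=> E a; have [x0 _] := curve_point X; have [D [_ _ ->]] := jac_span x0 a.
by rewrite !raddf_sum; apply: eq_bigr => x _; rewrite !raddfMz E.
Qed.

Lemma jac_pt_morphism x0 : morphism (curve_fn X) (gs_fn J) (jac_pt^~ x0).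
Proof. by have [_ _ _ _ /(_ x0) []] := jac_is_jacobian J. Qed.

Lemma jac_lift (A : gspace R) (f : X -> A) : abelian_variety A ->
  morphism (curve_fn X) (gs_fn A) f -> exists h : {additive J -> A},
    morphism (gs_fn J) (gs_fn A) h /\ forall x y, h (jac_pt x y) = f x - f y.
Proof.
move=> AA mf; have [x0 _] := curve_point X.
have [_ _ _ _ /(_ x0) [_ univ]] := jac_is_jacobian J.
have [|| h mh Eh] := univ A (fun x => f x - f x0) AA; last 1 first.
- exists h; split=> // x y; rewrite -(jac_pt_sub x y x0) raddfB /= /jac_pt !Eh.
  by rewrite opprB addrA subrK.
- apply: morphism_sub => //; [exact: curve_fs|exact: morphism_cst (curve_fs X)].
- exact: subrr.
Qed.
End OneJacobian.

(** [is_norm] prescribes only values on divisor classes. The universal property supplies a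
    homomorphism that is a morphism and has the same values on point differences, which generate the
    Jacobian. *)
Lemma is_norm_additive (X Y : curve R) (f : X -> Y) (JX : jacobian X) (JY : jacobian Y)
    (N : JX -> JY) : morphism (curve_fn X) (curve_fn Y) f -> is_norm f N ->
  exists h : {additive JX -> JY}, [/\ h =1 N, morphism (gs_fn JX) (gs_fn JY) h &
    forall x y, h (jac_pt JX x y) = jac_pt JY (f x) (f y)].
Proof.
move=> mf HN; have [x0 _] := curve_point X.
have [|h [mh Eh]] := @jac_lift _ JX JY (fun x => jac_pt JY (f x) (f x0)) (jac_abelian JY).
  exact: (morphism_comp mf (@jac_pt_morphism _ JY (f x0))).
have Eh' x y : h (jac_pt JX x y) = jac_pt JY (f x) (f y) by rewrite Eh jac_pt_sub.
exists h; split=> // a; have [D [dD Da Ea]] := jac_span x0 a.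
rewrite -{2}Da HN // /pushforward (cl_freeg_sum _ _ (f x0)); last by rewrite -deg_sum_coeff.
by rewrite Ea raddf_sum; apply: eq_bigr => x _; rewrite raddfMz Eh'.
Qed.
End Jacobians.

(** * Quotients and Prym varieties *)

Section Quotients.
Variables (R : realType) (X : curve R) (to : {action 'S_4 &-> X}).
Hypothesis toP : faithful_algebraic_action to.
Variable JX : jacobian X.

(* The library states [actM] and [act1] for actions on finite types only. *)
Lemma curve_actM x s t : to x (s * t)%g = to (to x s) t.
Proof. by case: (to) => act [_ actM] /=; apply: actM; rewrite inE. Qed.
Lemma curve_act1 x : to x 1%g = x.
Proof.
have inj : injective (to^~ 1%g) by case: (to) => act [inj _] /=; apply: inj.
by apply: inj; rewrite -curve_actM mulg1.
Qed.

Lemma jac_action : exists rho : 'S_4 -> {additive JX -> JX},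
  [/\ forall s, morphism (gs_fn JX) (gs_fn JX) (rho s),
      forall s x y, rho s (jac_pt JX x y) = jac_pt JX (to x s) (to y s),
      forall a, rho 1%g a = a &
      forall s t a, rho (s * t)%g a = rho t (rho s a)].
Proof.
have [x0 _] := curve_point X.
have H (s : 'S_4) : exists h : {additive JX -> JX}, morphism (gs_fn JX) (gs_fn JX) h /\
    forall x y, h (jac_pt JX x y) = jac_pt JX (to x s) (to y s).
  have [|h [mh Eh]] := @jac_lift _ _ JX JX (fun x => jac_pt JX (to x s) (to x0 s)) (jac_abelian JX).
    exact: (morphism_comp (toP.1 s) (@jac_pt_morphism _ _ JX (to x0 s))).
  by exists h; split=> // x y; rewrite Eh jac_pt_sub.
have [rho Hrho] := choice H; exists rho; split.
- by move=> s; case: (Hrho s).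
- by move=> s; case: (Hrho s).
- apply: (jac_ext (g := idfun)) => x y; have [_ ->] := Hrho 1%g.
  by rewrite !curve_act1.
- move=> s t; apply: (jac_ext (g := rho t \o rho s)) => x y /=.
  have [_ ->] := Hrho (s * t)%g; have [_ ->] := Hrho s; have [_ ->] := Hrho t.
  by rewrite !curve_actM.
Qed.

Variable rho : 'S_4 -> {additive JX -> JX}.
Hypothesis rho_morphism : forall s, morphism (gs_fn JX) (gs_fn JX) (rho s).
Hypothesis rhoE : forall s x y, rho s (jac_pt JX x y) = jac_pt JX (to x s) (to y s).

Section OneQuotient.
Variables (M : {group 'S_4}) (XM : quotient_curve to M) (JM : jacobian XM).

Lemma quo_morphism : morphism (curve_fn X) (curve_fn XM) (quo_proj XM).
Proof.
move=> U oU; split; first exact/quo_open.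
by move=> h rh; apply/(quo_regular h oU).
Qed.

(** Any set-theoretic section of the quotient map gives the factorization; it is a morphism because
    the topology and the regular functions of the quotient are those pulled back to X. *)
Lemma quotient_factor T (S : fstruct R T) (g : X -> T) :
  morphism (curve_fn X) S g -> (forall x s, s \in M -> g (to x s) = g x) ->
  exists2 g' : XM -> T, morphism (curve_fn XM) S g' & forall x, g' (quo_proj XM x) = g x.
Proof.
move=> mg ginv; have [sec Hsec] := choice (@quo_surj _ _ _ _ XM).
have E x : g (sec (quo_proj XM x)) = g x.
  have [s sM Ex] := (@quo_orbit _ _ _ _ XM (sec (quo_proj XM x)) x).1 (Hsec _).
  by rewrite [in RHS]Ex ginv.
exists (g \o sec) => // U oU; have [oV rV] := mg U oU.
have EU : quo_proj XM @^-1` ((g \o sec) @^-1` U) = g @^-1` U.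
  by apply/seteqP; split=> x /=; rewrite E.
have oU' : fn_open (curve_fn XM) ((g \o sec) @^-1` U) by apply/quo_open; rewrite EU.
split=> // h rh; apply/(quo_regular _ oU'); rewrite EU.
have -> : (h \o (g \o sec)) \o quo_proj XM = h \o g by apply/funext => x /=; rewrite E.
exact: rV.
Qed.

Definition orbit_norm (a : JX) : JX := \sum_(s in M) rho s a.

Lemma quotient_norm : exists nm : {additive JX -> JM}, exists pb : {additive JM -> JX},
  [/\ morphism (gs_fn JX) (gs_fn JM) nm, morphism (gs_fn JM) (gs_fn JX) pb,
      forall x y, nm (jac_pt JX x y) = jac_pt JM (quo_proj XM x) (quo_proj XM y) &
      forall a, pb (nm a) = orbit_norm a].
Proof.
have [x0 _] := curve_point X.
have AX := jac_abelian JX; have AM := jac_abelian JM.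
have [|nm [mnm Enm]] := @jac_lift _ _ JX JM (fun x => jac_pt JM (quo_proj XM x) (quo_proj XM x0)) AM.
  exact: (morphism_comp quo_morphism (@jac_pt_morphism _ _ JM _)).
have Enm' x y : nm (jac_pt JX x y) = jac_pt JM (quo_proj XM x) (quo_proj XM y).
  by rewrite Enm jac_pt_sub.
(* The fibre through x, counted with multiplicity, relative to x0; it is invariant under M, and its
   descent to X/M induces the pullback of divisor classes. *)
pose g x := \sum_(s in M) jac_pt JX (to x s) x0.
have mg : morphism (curve_fn X) (gs_fn JX) g.
  apply: (morphism_sum AX (curve_fs X)) => s.
  exact: (morphism_comp (toP.1 s) (@jac_pt_morphism _ _ JX x0)).
have ginv x s : s \in M -> g (to x s) = g x.
  move=> sM; rewrite /g; under eq_bigr do rewrite -curve_actM.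
  rewrite [RHS](reindex_inj (mulgI s)) /=; apply: eq_bigl => t.
  by rewrite groupMl.
have [g' mg' Eg'] := quotient_factor mg ginv.
have [pb [mpb Epb]] := jac_lift JM AX mg'.
exists nm, pb; split=> // a; rewrite /orbit_norm.
have [D [_ _ ->]] := jac_span x0 a.
rewrite !raddf_sum; under [RHS]eq_bigr do rewrite raddf_sum.
rewrite [RHS]exchange_big; apply: eq_bigr => x _.
rewrite !raddfMz Enm' Epb !Eg' /g -sumrB mulrz_suml.
apply: eq_bigr => s _.
by rewrite raddfMz rhoE jac_pt_sub.
Qed.

Variable nm : {additive JX -> JM}.
Hypothesis nmE : forall x y, nm (jac_pt JX x y) = jac_pt JM (quo_proj XM x) (quo_proj XM y).

Lemma norm_rho s a : s \in M -> nm (rho s a) = nm a.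
Proof.
move=> sM; apply: (jac_ext (f := nm \o rho s) (g := nm)) => x y /=.
rewrite rhoE !nmE.
have E z : quo_proj XM (to z s) = quo_proj XM z by apply/esym/quo_orbit; exists s.
by rewrite !E.
Qed.

Lemma norm_orbit_norm a : nm (orbit_norm a) = nm a *+ #|M|.
Proof.
rewrite /orbit_norm raddf_sum (eq_bigr (fun=> nm a)) ?sumr_const //.
by move=> s sM; apply: norm_rho.
Qed.

Lemma norm_surj b : exists a, nm a = b.
Proof.
have [sec Hsec] := choice (@quo_surj _ _ _ _ XM).
have [y0 _] := curve_point XM; have [D [_ _ ->]] := jac_span y0 b.
exists (\sum_(y <- dom D) jac_pt JX (sec y) (sec y0) *~ coeff y D).
rewrite raddf_sum; apply: eq_bigr => y _.
by rewrite raddfMz nmE !Hsec.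
Qed.

(** Nm_M of the sum over the orbit is |M| Nm_M, and |M| divides 24. The multiplier 24, common to all
    M, lets a single multiple of a point serve all components at once. *)
Lemma orbit_norm_eq0 a : orbit_norm a = 0 -> nm (a *+ #|grpS4|) = 0.
Proof.
move=> H; have /dvdnP[k ->] : (#|M| %| #|grpS4|)%N.
  by apply: cardSg; apply: finset.subsetT.
by rewrite mulnC mulrnA raddfMn raddfMn -norm_orbit_norm H raddf0 mul0rn.
Qed.
End OneQuotient.

Definition prym_op (M N : {group 'S_4}) (a : JX) : JX :=
  orbit_norm M (a *+ #|N| - orbit_norm N a).

Lemma connected_image T T' (S : fstruct R T) (S' : fstruct R T') (f : T -> T') :
  irreducible_set S setT -> morphism S S' f -> connected_set S' (range f).
Proof.
move=> [_ irr] mf U V oU oV cov disj; apply: contrapT => /not_orP[nU nV].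
have [oU' _] := mf _ oU; have [oV' _] := mf _ oV.
have ex W W' : (range f `<=` W `|` W') -> ~ (range f `<=` W) -> [set: T] `&` (f @^-1` W') !=set0.
  move=> cov' nW; apply: contrapT => no; apply: nW => _ [x _ <-].
  have [//|W'x] : (W `|` W') (f x) by apply: cov'; exists x.
  by case: no; exists x.
have [||x [_ [Ux Vx]]] := irr _ _ oU' oV'.
- by apply: (ex V) => //; rewrite setUC.
- exact: (ex U).
suff : (range f `&` (U `&` V)) (f x) by rewrite disj.
by split=> //; exists x.
Qed.

(** [prym_op] is psi followed by the pullback J(X/M) -> JX. Pulling back loses only torsion, which
    accounts for the factor in the last clause and makes the kernel of psi accessible inside
    Z[S_4]. *)
Lemma prym_map (M N : {group 'S_4}) (XM : quotient_curve to M) (XN : quotient_curve to N)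
    (f : XM -> XN) (JM : jacobian XM) (JN : jacobian XN) (P : prym f JM JN) :
  induced_morphism f -> exists psi : {additive JX -> P},
  [/\ morphism (gs_fn JX) (gs_fn P) psi, forall p, exists a, psi a = p,
      forall a, psi a = 0 -> prym_op M N a = 0 &
      forall a, prym_op M N a = 0 -> psi (a *+ #|grpS4|) = 0].
Proof.
move=> [mf Ef]; have AX := jac_abelian JX; have AM := jac_abelian JM.
have FX := abelian_fs AX; have FM := abelian_fs AM.
have [nm [pb [mnm mpb nmE pbE]]] := quotient_norm JM.
have [nN [pN [mnN mpN nNE pNE]]] := quotient_norm JN.
have [h [hE mh hpt]] := is_norm_additive mf (prym_is_norm P).
have h_nm a : h (nm a) = nN a.
  apply: (jac_ext (f := h \o nm) (g := nN)) => x y /=.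
  by rewrite nmE hpt nNE !Ef.
set n := #|N|; have n_gt0 : (0 < n)%N by apply: cardG_gt0.
pose q a := a *+ n - orbit_norm N a.
have q_add : additive q.
  by move=> a b; rewrite /q mulrnBl -!pNE !raddfB /= addrACA.
pose F := GRing.isAdditive.Build _ _ _ q_add.
pose qh : {additive JX -> JX} := HB.pack q F.
pose phi : {additive JX -> JM} := nm \o qh.
have mphi : morphism (gs_fn JX) (gs_fn JM) phi.
  apply: (@morphism_comp _ _ _ _ _ _ _ q nm _ mnm).
  apply: (morphism_sub AX FX); first by apply: (morphism_muln AX FX); apply: morphism_id.
  exact: (morphism_sum AX FX).
have h_phi a : h (phi a) = 0.
  rewrite /phi /= h_nm /q raddfB raddfMn /= (norm_orbit_norm nNE) subrr //.
have ker_phi b : h b = 0 -> exists a, b *+ n = phi a.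
  have [a <-] := norm_surj nmE b; rewrite h_nm => na0.
  by exists a; rewrite /phi /= /q -pNE na0 raddf0 subr0 raddfMn.
have closedB : fn_closed (gs_fn JM) (range phi) := image_closed AX AM mphi.
set Z := component (gs_fn JM) [set a | prym_norm P a = 0] 0.
have ZE : Z = range phi.
  apply/seteqP; split=> [y [A [cA AK A0 Ay]]|_ [a _ <-]]; last first.
    exists (range phi); split.
    + by apply: connected_image mphi; have [_ irr _ _] := AX; exact: irr.
    + by move=> _ [b _ <-] /=; rewrite -hE; exact: h_phi.
    + by exists 0 => //; rewrite raddf0.
    + by exists a.
  have {}AK z : A z -> h z = 0 by move=> /AK /=; rewrite hE.
  have /finite_seqP [s Es] := torsion_finite AM n_gt0.
  have split_z z : h z = 0 -> exists a, (z - phi a) \in s.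
    move=> hz; have [a Ea] := ker_phi z hz; have [a' Ea'] := abelian_divisible AX n_gt0 a.
    exists a'; have : [set b : JM | b *+ n = 0] (z - phi a').
      by rewrite /= mulrnBl Ea Ea' raddfMn subrr.
    by rewrite Es.
  (* U is the complement of the finitely many cosets t + B different from B with t in s. On the
     kernel of h it coincides with B, so U and the complement of B separate B from the rest of any
     connected set there. *)
  pose U := [set z | forall t, t \in s -> ~ range phi t -> ~ range phi (z - t)].
  have oU : fn_open (gs_fn JM) U.
    rewrite /U; elim: (s) => [|t s' IH].
      rewrite (_ : [set z | _] = setT); first exact: (fs_openT FM).
      by apply/seteqP; split.
    have [tB|ntB] := pselect (range phi t).
      rewrite (_ : [set z | _] = [set z | forall t, t \in s' -> ~ range phi t -> ~ range phi (z - t)]) //.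
      apply/seteqP; split=> z /= Hz t'; first by move=> t's; apply: Hz; rewrite inE t's orbT.
      by rewrite inE => /orP[/eqP ->|]; [|apply: Hz].
    rewrite (_ : [set z | _] = [set z | forall t, t \in s' -> ~ range phi t -> ~ range phi (z - t)]
       `&` [set z | ~ range phi (z - t)]).
      apply: (fs_openI FM) => //.
      apply: (@closed_preim _ JM _ (gs_fn JM) (fun z => z - t)) closedB.
      by apply: (morphism_sub AM FM); [apply: morphism_id|apply: morphism_cst].
    apply/seteqP; split=> z /=.
      move=> Hz; split; last by apply: Hz; rewrite ?mem_head.
      by move=> t' t's; apply: Hz; rewrite inE t's orbT.
    by move=> [Hz Hzt] t'; rewrite inE => /orP[/eqP ->//|]; apply: Hz.
  have [||AU|AV] := cA U (~` range phi) oU closedB.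
  - move=> z Az; have [zB|] := pselect (range phi z); last by right.
    left=> t _ nt [b _ Eb]; apply: nt; case: zB => a _ Ea.
    by exists (a - b) => //; rewrite raddfB Eb Ea subKr.
  - apply/seteqP; split=> // z [Az [Uz nzB]]; have [a za] := split_z z (AK z Az).
    apply: (Uz _ za); last by exists a => //; rewrite subKr.
    move=> [b _ Eb]; apply: nzB; exists (b + a) => //; by rewrite raddfD Eb subrK.
  - have [a ya] := split_z y (AK y Ay).
    have [[b _ Eb]|nB] := pselect (range phi (y - phi a)).
      by exists (b + a) => //; rewrite raddfD Eb subrK.
    by case: (AU y Ay _ ya nB); exists a => //; rewrite subKr.
  - by case: (AV 0 A0); exists 0 => //; rewrite raddf0.
have [k [mk [g [mg kg gk]]] Ek] := prym_incl_isom P.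
have phiZ a : Z (phi a) by rewrite ZE; exists a.
pose phiZ' a : Z := SigSub (mem_set (phiZ a)).
have incl_inj : injective (prym_incl P).
  by move=> p p'; rewrite !Ek => /val_inj /(can_inj kg).
pose psi a := g (phiZ' a).
have psiE a : prym_incl P (psi a) = phi a by rewrite Ek /psi gk.
have psi_add : additive psi.
  by move=> a b; apply: incl_inj; rewrite raddfB !psiE raddfB.
pose F' := GRing.isAdditive.Build _ _ _ psi_add.
pose psih : {additive JX -> P} := HB.pack psi F'.
have psi0 a : psi a = 0 <-> phi a = 0.
  split=> [H|H]; first by rewrite -psiE H raddf0.
  by apply: incl_inj; rewrite psiE H raddf0.
exists psih; split.
- apply: (morphism_comp _ mg); exact: (@morphism_factor _ _ _ _ (gs_fn JM) Z phiZ' FX).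
- move=> p; have : Z (prym_incl P p) by rewrite Ek; apply: set_valP.
  rewrite ZE => -[a _ Ea]; exists a; apply: incl_inj; by rewrite psiE.
- by move=> a /psi0 H; rewrite /prym_op -/(q a) -pbE [nm _]H raddf0.
- by move=> a H; apply/psi0; rewrite raddfMn -[phi a]/(nm (q a)) -raddfMn; apply: (orbit_norm_eq0 nmE).
Qed.
End Quotients.

(** * The isogeny *)

Lemma lists_S4 : lists_codes codes grpS4.
Proof. by split=> //; exact: mem_grpS4. Qed.
Lemma lists_A4 : lists_codes codesA4 grpA4.
Proof. by split; [apply/allP; vm_compute|vm_compute|exact: mem_grpA4]. Qed.
Lemma lists_S3 : lists_codes codesS3 grpS3.
Proof. by split; [apply/allP; vm_compute|vm_compute|exact: mem_grpS3]. Qed.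
Lemma lists_D4 : lists_codes codesD4 grpD4.
Proof. by split; [apply/allP; vm_compute|vm_compute|exact: mem_grpD4]. Qed.
Lemma lists_Z : lists_codes codesZ grpZ.
Proof. by split; [apply/allP; vm_compute|vm_compute|exact: mem_grpZ]. Qed.

Section ComponentOperators.
Variables (R : realType) (X : curve R) (JX : jacobian X).
Variable rho : 'S_4 -> {additive JX -> JX}.
Hypothesis rho1 : forall a, rho 1%g a = a.
Hypothesis rhoM : forall s t a, rho (s * t)%g a = rho t (rho s a).

Lemma gev_orbit_norm L (M : {group 'S_4}) a : lists_codes L M ->
  gev rho (gset L) a = orbit_norm rho M a.
Proof. exact: gev_set. Qed.

Lemma comp_op_norm L (M : {group 'S_4}) s a : lists_codes L M ->
  gev rho (comp_op (ComponentData L gone s)) a = orbit_norm rho M a.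
Proof.
move=> HL; rewrite /comp_op (gev_mul rhoM) ?gwf_norm // (gev_one rho1).
exact: gev_orbit_norm.
Qed.

Lemma comp_op_prym LM LN (M N : {group 'S_4}) c s a : lists_codes LM M -> lists_codes LN N ->
  int_of_Z c = (size LN)%:Z ->
  gev rho (comp_op (ComponentData LM (diff_norm c LN) s)) a = prym_op rho M N a.
Proof.
move=> HM HN Ec; rewrite /comp_op (gev_mul rhoM) ?gwf_norm //.
rewrite (gev_orbit_norm _ HM) /prym_op; congr (orbit_norm rho M _).
rewrite gev_add ?gwf_scale ?gwf_norm // !gev_scale (gev_one rho1) (gev_orbit_norm _ HN).
by rewrite Ec (card_codes HN) mulrN1z.
Qed.
End ComponentOperators.

Lemma pair_hom (R : realType) (J A B : gspace R) (f : {additive J -> A}) (g : {additive J -> B}) :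
  function_space (gs_fn J) -> morphism (gs_fn J) (gs_fn A) f -> morphism (gs_fn J) (gs_fn B) g ->
  exists h : {additive J -> gprod A B},
    morphism (gs_fn J) (gs_fn (gprod A B)) h /\ forall a, h a = (f a, g a).
Proof.
move=> FJ mf mg; pose h (a : J) : gprod A B := (f a, g a).
have h_add : additive h by move=> a b; rewrite /h !raddfB.
pose F := GRing.isAdditive.Build _ _ _ h_add.
pose hh : {additive J -> gprod A B} := HB.pack h F.
by exists hh; split=> //; apply: morphism_pair.
Qed.

Theorem proposition5p1 (R : realType) (X : curve R)
  (g : nat) (genusX : genus (curve_fn X) g) (g_ge2 : (2 <= g)%N)
  (to : {action 'S_4 &-> X}) (toP : faithful_algebraic_action to)
  (Y : quotient_curve to grpS4)
  (XA4 : quotient_curve to grpA4) (XS3 : quotient_curve to grpS3)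
  (XD4 : quotient_curve to grpD4) (XZ : quotient_curve to grpZ)
  (fA4 : XA4 -> Y) (fA4P : induced_morphism fA4)
  (fS3 : XS3 -> Y) (fS3P : induced_morphism fS3)
  (fD4 : XD4 -> Y) (fD4P : induced_morphism fD4)
  (fZ : XZ -> XD4) (fZP : induced_morphism fZ)
  (JX : jacobian X) (JY : jacobian Y) (JA4 : jacobian XA4)
  (JS3 : jacobian XS3) (JD4 : jacobian XD4) (JZ : jacobian XZ)
  (PA4 : prym fA4 JA4 JY) (PD4 : prym fD4 JD4 JY)
  (PS3 : prym fS3 JS3 JY) (PZ : prym fZ JZ JD4) :
  isogenous JX
    (gprod JY (gprod PA4 (gprod (gpow PD4 2)
      (gprod (gpow PS3 3) (gpow PZ 3))))).
Proof.
have AX := jac_abelian JX; have FX := abelian_fs AX.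
have [rho [mrho rhoE rho1 rhoM]] := jac_action toP JX.
have [nm [pb [mnm _ nmE pbE]]] := quotient_norm toP rhoE JY.
have [psiA [mA sA A1 A2]] := prym_map toP mrho rhoE PA4 fA4P.
have [psiD [mD sD D1 D2]] := prym_map toP mrho rhoE PD4 fD4P.
have [psiS [mS sS S1 S2]] := prym_map toP mrho rhoE PS3 fS3P.
have [psiZ [mZ sZ Z1 Z2]] := prym_map toP mrho rhoE PZ fZP.
pose S4 := #|grpS4|; have S4_gt0 : (0 < S4)%N by apply: cardG_gt0.
have nm1 a : nm a = 0 -> orbit_norm rho grpS4 a = 0.
  by move=> H; rewrite -pbE H raddf0.
have nm2 a : orbit_norm rho grpS4 a = 0 -> nm (a *+ S4) = 0.
  exact: (orbit_norm_eq0 rhoE nmE).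
pose r i := rho (shift_at i).
have m_r (B : gspace R) (f : {additive JX -> B}) i : morphism (gs_fn JX) (gs_fn B) f ->
    morphism (gs_fn JX) (gs_fn B) (f \o r i).
  by move=> mf; apply: (morphism_comp (mrho _) mf).
have [hZ1 [mZ1 hZ1E]] := pair_hom FX (m_r _ psiZ 8 mZ) (m_r _ psiZ 9 mZ).
have [hZ0 [mZ0 hZ0E]] := pair_hom FX (m_r _ psiZ 7 mZ) mZ1.
have [hS1 [mS1 hS1E]] := pair_hom FX (m_r _ psiS 5 mS) (m_r _ psiS 6 mS).
have [hS0 [mS0 hS0E]] := pair_hom FX (m_r _ psiS 4 mS) mS1.
have [hD0 [mD0 hD0E]] := pair_hom FX (m_r _ psiD 2 mD) (m_r _ psiD 3 mD).
have [h1 [m1 h1E]] := pair_hom FX mS0 mZ0.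
have [h2 [m2 h2E]] := pair_hom FX mD0 m1.
have [h3 [m3 h3E]] := pair_hom FX (m_r _ psiA 1 mA) m2.
have [h [mh hE]] := pair_hom FX (m_r _ nm 0 mnm) m3.
have {}hE a : h a = (nm (r 0 a), (psiA (r 1 a), ((psiD (r 2 a), psiD (r 3 a)),
   ((psiS (r 4 a), (psiS (r 5 a), psiS (r 6 a))), (psiZ (r 7 a), (psiZ (r 8 a), psiZ (r 9 a))))))).
  by rewrite hE h3E h2E h1E hD0E hS0E hS1E hZ0E hZ1E.
have op0 a : gev rho (op_at 0) a = orbit_norm rho grpS4 a.
  exact: comp_op_norm lists_S4.
have op1 a : gev rho (op_at 1) a = prym_op rho grpA4 grpS4 a.
  exact: (comp_op_prym rho1 rhoM _ _ lists_A4 lists_S4).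
have opD a i : (i = 2 \/ i = 3)%N -> gev rho (op_at i) a = prym_op rho grpD4 grpS4 a.
  by move=> [] ->; apply: (comp_op_prym rho1 rhoM _ _ lists_D4 lists_S4).
have opS a i : [\/ i = 4, i = 5 | i = 6]%N -> gev rho (op_at i) a = prym_op rho grpS3 grpS4 a.
  by move=> [] ->; apply: (comp_op_prym rho1 rhoM _ _ lists_S3 lists_S4).
have opZ a i : [\/ i = 7, i = 8 | i = 9]%N -> gev rho (op_at i) a = prym_op rho grpZ grpD4 a.
  by move=> [] ->; apply: (comp_op_prym rho1 rhoM _ _ lists_Z lists_D4).
exists h; split=> //.
- move=> [y0 [y1 [[y2 y3] [[y4 [y5 y6]] [y7 [y8 y9]]]]]].
  have [L L_gt0 HL] := decomposition_surjective rhoM.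
  (* The preimage is taken divisible by both L and 24: L matches [decomposition_surjective], and 24
     allows passing from the vanishing of an operator to that of the map. *)
  have lift (B : zmodType) (f : {additive JX -> B}) y : (exists a, f a = y) ->
      exists b, f (b *+ L *+ S4) = y.
    move=> [a <-]; have [b ->] := abelian_divisible AX S4_gt0 a.
    by have [c ->] := abelian_divisible AX L_gt0 b; exists c.
  have [b0 <-] := lift _ nm y0 (norm_surj nmE y0).
  have [b1 <-] := lift _ psiA y1 (sA y1).
  have [b2 <-] := lift _ psiD y2 (sD y2); have [b3 <-] := lift _ psiD y3 (sD y3).
  have [b4 <-] := lift _ psiS y4 (sS y4); have [b5 <-] := lift _ psiS y5 (sS y5).
  have [b6 <-] := lift _ psiS y6 (sS y6).
  have [b7 <-] := lift _ psiZ y7 (sZ y7); have [b8 <-] := lift _ psiZ y8 (sZ y8).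
  have [b9 <-] := lift _ psiZ y9 (sZ y9).
  have [a Ha] := HL (nth 0 [:: b0; b1; b2; b3; b4; b5; b6; b7; b8; b9]).
  exists (a *+ S4); rewrite hE.
  have E (B : zmodType) (f : {additive JX -> B}) i (b : JX) :
      f ((rho (shift_at i) a - b *+ L) *+ S4) = 0 -> f (r i (a *+ S4)) = f (b *+ L *+ S4).
    by rewrite mulrnBl raddfB => /eqP; rewrite subr_eq0 /r -raddfMn => /eqP.
  congr (_, (_, ((_, _), ((_, (_, _)), (_, (_, _)))))); apply: E.
  + by apply: nm2; rewrite -op0; apply: (Ha 0%N).
  + by apply: A2; rewrite -op1; apply: (Ha 1%N).
  + by apply: D2; rewrite -(opD _ 2); [apply: (Ha 2)|left].
  + by apply: D2; rewrite -(opD _ 3); [apply: (Ha 3)|right].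
  + by apply: S2; rewrite -(opS _ 4); [apply: (Ha 4)|constructor 1].
  + by apply: S2; rewrite -(opS _ 5); [apply: (Ha 5)|constructor 2].
  + by apply: S2; rewrite -(opS _ 6); [apply: (Ha 6)|constructor 3].
  + by apply: Z2; rewrite -(opZ _ 7); [apply: (Ha 7)|constructor 1].
  + by apply: Z2; rewrite -(opZ _ 8); [apply: (Ha 8)|constructor 2].
  + by apply: Z2; rewrite -(opZ _ 9); [apply: (Ha 9)|constructor 3].
have [K K_gt0 HK] := decomposition_injective rho1 rhoM.
apply: (sub_finite_set _ (torsion_finite AX K_gt0)) => a ha.
have : h a = 0 := ha; rewrite hE => -[].
move=> /nm1 e0 /A1 e1 /D1 e2 /D1 e3 /S1 e4 /S1 e5 /S1 e6 /Z1 e7 /Z1 e8 /Z1 e9.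
apply: HK; case=> [_|[_|[_|[_|[_|[_|[_|[_|[_|[_|i hi]]]]]]]]]].
- by rewrite op0; apply: e0.
- by rewrite op1; apply: e1.
- by rewrite opD; [apply: e2|left].
- by rewrite opD; [apply: e3|right].
- by rewrite opS; [apply: e4|constructor 1].
- by rewrite opS; [apply: e5|constructor 2].
- by rewrite opS; [apply: e6|constructor 3].
- by rewrite opZ; [apply: e7|constructor 1].
- by rewrite opZ; [apply: e8|constructor 2].
- by rewrite opZ; [apply: e9|constructor 3].
- by [].
Qed.
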